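(* Let $\mathscr{H},\mathscr{K}$ be Hilbert spaces and let $0<m<M$. Let $A_1,\ldots,A_n\in\mathbb{B}(\mathscr{H})$ be positive invertible operators with $\sigma(A_i)\subseteq[m,M]$, and let $\Phi_1,\ldots,\Phi_n:\mathbb{B}(\mathscr{H})\to\mathbb{B}(\mathscr{K})$ be positive linear maps with $\sum_{i=1}^n\Phi_i(\mathbf{1}_{\mathscr{H}})=\mathbf{1}_{\mathscr{K}}$. Let $\varphi,\psi:[m,M]\to\mathbb{R}$ be two continuous strictly monotonic functions such that $\psi\circ\varphi^{-1}$ is twice differentiable. Write $\widetilde{M}_\varphi$ and $\widetilde{M}_\psi$ for the operator quasi-arithmetic means of Mercer's type of $(A_1,\ldots,A_n)$ with respect to $(\Phi_1,\ldots,\Phi_n)$ (defined in the context), and put $$K:=(\varphi(M)+\varphi(m))\sum_{i=1}^n\Phi_i(\varphi(A_i))-\varphi(M)\varphi(m)\mathbf{1}_{\mathscr{K}}-\frac12\left(\left(\sum_{i=1}^n\Phi_i(\varphi(A_i))\right)^2+\sum_{i=1}^n\Phi_i\left(\varphi(A_i)^2\right)\right).$$ (i) If $\alpha\le(\psi\circ\varphi^{-1})''$ with $\alpha\in\mathbb{R}$ and $\psi^{-1}$ is operator monotone, then $$\widetilde{M}_\varphi\le\psi^{-1}\left\{\psi(\widetilde{M}_\psi)-\alpha K\right\}.$$ (ii) If $(\psi\circ\varphi^{-1})''\le\beta$ with $\beta\in\mathbb{R}$ and $\psi^{-1}$ is operator monotone, then $$\widetilde{M}_\varphi\ge\psi^{-1}\left\{\psi(\widetilde{M}_\psi)-\beta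 K\right\}.$$
   Context: $\mathbb{B}(\mathscr{H})$ is the $C^*$-algebra of all bounded linear operators on $\mathscr{H}$, $\mathbf{1}_{\mathscr{H}}$ is the identity operator and $\sigma(A)$ the spectrum of $A$. $A\ge 0$ means $\langle Ax,x\rangle\ge 0$ for all $x$; for self-adjoint $A,B$, $A\le B$ means $B-A\ge 0$. A linear map $\Phi:\mathbb{B}(\mathscr{H})\to\mathbb{B}(\mathscr{K})$ is positive if $\Phi(A)\ge 0$ whenever $A\ge 0$. Functions of self-adjoint operators are defined by the continuous functional calculus. For a continuous strictly monotonic $\varphi:[m,M]\to\mathbb{R}$, the operator quasi-arithmetic mean of Mercer's type is $$\widetilde{M}_\varphi:=\varphi^{-1}\left((\varphi(M)+\varphi(m))\mathbf{1}_{\mathscr{K}}-\sum_{i=1}^n\Phi_i(\varphi(A_i))\right),$$ where $\varphi^{-1}$ is the inverse function of $\varphi$; $\widetilde{M}_\psi$ is defined in the same way with $\psi$ in place of $\varphi$. A continuous real function $g$ on an interval $I$ is operator monotone (also called operator increasing) if $g(A)\le g(B)$ whenever $A,B$ are self-adjoint operators with spectra in $I$ and $A\le B$.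
   Formalization: For α<0 in (i) and β>0 in (ii), it is assumed that the spectrum of ψ(M̃_ψ)−αK (resp. ψ(M̃_ψ)−βK) lies in ψ([m,M]), the domain of ψ^{-1}; otherwise the right-hand side may be undefined. *)

(* Defs.v *)
From HB Require Import structures.
From mathcomp Require Import all_boot all_order all_algebra.
From mathcomp Require Import all_classical all_reals all_analysis.
From mathcomp Require Import complex.

Set Implicit Arguments.
Unset Strict Implicit.
Unset Printing Implicit Defensive.

Import Order.TTheory GRing.Theory Num.Theory.
Import numFieldNormedType.Exports.

Local Open Scope classical_set_scope.
Local Open Scope ring_scope.
Local Open Scope complex_scope.

(* Complex Hilbert spaces, of arbitrary dimension.  The inner product is linear
   in its first argument; since [`|x|] is a norm, [inner_normE] also makes it
   positive definite. *)
HB.mixin Record NormedModule_isHilbert (R : realType) (H : Type)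
    of NormedModule R[i] H := {
  inner : H -> H -> R[i];
  inner_linearl : forall (a : R[i]) (x y z : H),
    inner (a *: x + y) z = a * inner x z + inner y z;
  inner_conj : forall x y : H, inner y x = (inner x y)^*;
  inner_normE : forall x : H, inner x x = `|x| ^+ 2
}.

#[short(type="hilbertType")]
HB.structure Definition Hilbert (R : realType) :=
  { H of CompleteNormedModule R[i] H & NormedModule_isHilbert R H }.

Section BoundedOperators.
Context {R : realType} {H : hilbertType R}.

Definition bounded_linear (f : H -> H) : Prop :=
  linear f /\ exists k : R, forall x, `|f x| <= k%:C * `|x|.

Definition bop_pred : {pred H -> H} := [pred f | `[< bounded_linear f >]].

Record bop := Bop { bop_fun :> H -> H; bop_funP : bop_fun \in bop_pred }.

HB.instance Definition _ := [isSub for bop_fun].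
HB.instance Definition _ := [Choice of bop by <:].

Lemma bop_predP f : reflect (bounded_linear f) (f \in bop_pred).
Proof. exact: asboolP. Qed.

Lemma bop_linear (A : bop) : linear A.
Proof. by have /bop_predP[] := bop_funP A. Qed.

Lemma bop_bounded (A : bop) : exists2 k : R, 0 <= k &
  forall x, `|A x| <= k%:C * `|x|.
Proof.
have /bop_predP[_ [k Ak]] := bop_funP A.
exists `|k|%R => // x; apply: le_trans (Ak x) _.
by apply: ler_wpM2r; rewrite // lecR ler_norm.
Qed.

Lemma bop_submod_closed : submod_closed bop_pred.
Proof.
split=> [|a f g].
  apply/bop_predP; split=> [b x y|].
    by rewrite scaler0 addr0.
  by exists 0 => x; rewrite normr0 mul0r.
move=> fP gP.
have [k k0 fk] := bop_bounded (Bop fP); have [l l0 gl] := bop_bounded (Bop gP).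
have E x : (a *: f + g) x = a *: f x + g x by [].
apply/bop_predP; split=> [b x y|].
  rewrite !E [f _](bop_linear (Bop fP)) [g _](bop_linear (Bop gP)) /=.
  rewrite !scalerDr !scalerA (mulrC a b) -!addrA; congr (_ + _).
  by rewrite addrCA.
have [r r0 ar] : exists2 r : R, 0 <= r & `|a| = r%:C.
  exists (complex.Re `|a|); last by rewrite RRe_real ?normr_real.
  by rewrite -lecR RRe_real ?normr_real ?normr_ge0.
exists (r * k + l) => x.
apply: le_trans (ler_normD _ _) _.
rewrite normrZ ar rmorphD rmorphM mulrDl -mulrA.
by apply: lerD; [apply: ler_wpM2l; [rewrite lecR|exact: fk] | exact: gl].
Qed.

HB.instance Definition _ :=
  GRing.isSubmodClosed.Build R[i] (H -> H) bop_pred bop_submod_closed.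
HB.instance Definition _ := [SubChoice_isSubLmodule of bop by <:].

Lemma bop_one_subproof : (@id H) \in bop_pred.
Proof. by apply/bop_predP; split=> //; exists 1 => x; rewrite mul1r. Qed.

Definition bop_one : bop := Bop bop_one_subproof.

Lemma bop_mul_subproof (A B : bop) : A \o B \in bop_pred.
Proof.
have [k k0 Ak] := bop_bounded A; have [l l0 Bl] := bop_bounded B.
apply/bop_predP; split=> [a x y|]; first by rewrite /= !bop_linear.
exists (k * l) => x; apply: le_trans (Ak _) _.
by rewrite rmorphM -mulrA; apply: ler_wpM2l; rewrite ?lecR.
Qed.

Definition bop_mul (A B : bop) : bop := Bop (bop_mul_subproof A B).

Lemma bop_ext (A B : bop) : (A : H -> H) =1 B -> A = B.
Proof. by move=> AB; apply: val_inj; apply/funext. Qed.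

Lemma bop_addE (A B : bop) x : (A + B) x = A x + B x. Proof. by []. Qed.

Lemma bop_mulA : associative bop_mul.
Proof. by move=> A B C; apply: bop_ext. Qed.
Lemma bop_mul1l : left_id bop_one bop_mul.
Proof. by move=> A; apply: bop_ext. Qed.
Lemma bop_mul1r : right_id bop_one bop_mul.
Proof. by move=> A; apply: bop_ext. Qed.
Lemma bop_mulDl : left_distributive bop_mul +%R.
Proof. by move=> A B C; apply: bop_ext. Qed.
Lemma bop_mulDr : right_distributive bop_mul +%R.
Proof.
move=> A B C; apply: bop_ext => x.
have := bop_linear A 1 (B x) (C x); rewrite !scale1r => E.
by rewrite bop_addE /= -E.
Qed.

(* Only a [pzRingType]: [H] may be the zero space, where [0 = 1]. *)
HB.instance Definition _ := GRing.Zmodule_isPzRing.Build bop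
  bop_mulA bop_mul1l bop_mul1r bop_mulDl bop_mulDr.

End BoundedOperators.
Arguments bop {R} H.

Notation "''B(' H )" := (bop H) (format "''B(' H )") : type_scope.

Section Operators.
Context {R : realType} {H : hilbertType R}.
Implicit Types A B : 'B(H).

Definition selfadjoint A : Prop :=
  forall x y : H, inner (A x) y = inner x (A y).

(* In [R[i]], [0 <= z] says that [z] is real and nonnegative. *)
Definition posop A : Prop := forall x : H, 0 <= inner (A x) x.

Definition leop A B : Prop := posop (B - A).

Definition invertible A : Prop := exists B, A * B = 1 /\ B * A = 1.

Definition spectrum A : set R[i] :=
  [set z | ~ invertible (A - z *: (1 : 'B(H)))].

Definition spectrum_in A (I : set R) : Prop :=
  spectrum A `<=` [set t%:C | t in I].

Definition op_poly (p : {poly R}) A : 'B(H) :=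
  \sum_(i < size p) (p`_i)%:C *: A ^+ i.

(* Continuous functional calculus of a self-adjoint [A] (whose spectrum is
   real): [f(A)] is the limit in operator norm of [p(A)] for polynomials [p]
   converging to [f] uniformly on the spectrum of [A].  It exists and is unique
   when [f] is continuous on the spectrum. *)
Definition is_cfc (f : R -> R) A B : Prop :=
  forall eps : R, 0 < eps -> exists p : {poly R},
    (forall t : R, spectrum A t%:C -> `|p.[t] - f t| <= eps) /\
    (forall x : H, `|(op_poly p A - B) x| <= eps%:C * `|x|).

Definition cfc (f : R -> R) A : 'B(H) := xget 0 [set B | is_cfc f A B].

End Operators.

Definition positive_map {R : realType} {H K : hilbertType R}
  (Phi : 'B(H) -> 'B(K)) : Prop := forall A, posop A -> posop (Phi A).

Definition operator_monotone {R : realType} (I : set R) (g : R -> R) : Prop :=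
  {within I, continuous g} /\
  forall (H : hilbertType R) (A B : 'B(H)), selfadjoint A -> selfadjoint B ->
    spectrum_in A I -> spectrum_in B I -> leop A B -> leop (cfc g A) (cfc g B).

Section RealFunctions.
Context {R : realType}.
Implicit Types (D : set R) (f : R -> R).

Definition strictly_monotone D f : Prop :=
  {in D &, {homo f : s t / s < t}} \/ {in D &, {homo f : s t /~ s < t}}.

(* Derivatives of a function with domain [D]: the difference quotients only
   involve points of [D], so they are one-sided at an endpoint of an interval. *)
Definition diff_quot f (t s : R) : R := (f s - f t) / (s - t).

Definition derivable_on D f (t : R) : Prop :=
  cvg (diff_quot f t s @[s --> within D t^']).

Definition deriv_on D f (t : R) : R :=
  lim (diff_quot f t s @[s --> within D t^']).

Definition twice_derivable_on D f : Prop :=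
  (forall t, D t -> derivable_on D f t) /\
  (forall t, D t -> derivable_on D (deriv_on D f) t).

Definition deriv2_on D f : R -> R := deriv_on D (deriv_on D f).

End RealFunctions.

Section Mercer.
Context {R : realType} {H K : hilbertType R} {n : nat}.
Variables (m M : R) (A : 'I_n -> 'B(H)) (Phi : 'I_n -> {linear 'B(H) -> 'B(K)}).

Definition finv_on (phi : R -> R) : R -> R := pinv `[m, M] phi.

Definition mercer_mean (phi : R -> R) : 'B(K) :=
  cfc (finv_on phi)
    ((phi M + phi m)%:C *: (1 : 'B(K)) - \sum_(i < n) Phi i (cfc phi (A i))).

Definition mercer_K (phi : R -> R) : 'B(K) :=
  (phi M + phi m)%:C *: (\sum_(i < n) Phi i (cfc phi (A i)))
  - (phi M * phi m)%:C *: (1 : 'B(K))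
  - (2^-1 : R)%:C *: ((\sum_(i < n) Phi i (cfc phi (A i))) ^+ 2
                      + \sum_(i < n) Phi i (cfc phi (A i) ^+ 2)).

End Mercer.

(* Main.v *)
Require Import Defs.
From HB Require Import structures.
From mathcomp Require Import all_boot all_order all_algebra.
From mathcomp Require Import all_classical all_reals all_analysis.
From mathcomp Require Import complex ring lra.

Set Implicit Arguments.
Unset Strict Implicit.
Unset Printing Implicit Defensive.

Import Order.TTheory GRing.Theory Num.Theory.
Import numFieldNormedType.Exports.

Local Open Scope classical_set_scope.
Local Open Scope ring_scope.
Local Open Scope complex_scope.

(* Let [f := psi o phi^-1] on [[a, b] = phi([m, M])].  If [f'' >= alpha], then
   [f <= q] on [[a, b]], where [q] is the quadratic polynomial with leading
   coefficient [alpha / 2] that agrees with [f] at [a] and [b].  Put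
   [X := a + b - \sum_i Phi_i (phi (A_i))].  Since [q] is quadratic, [q(X)] equals
   [q(a) + q(b) - \sum_i Phi_i (q (phi (A_i))) - alpha K] exactly, so positivity
   of the functional calculus and of the [Phi_i] gives
   [f(X) <= psi(M) + psi(m) - \sum_i Phi_i (psi (A_i)) - alpha K], and it remains
   to apply [psi^-1].

   The functional calculus rests on two facts about a self-adjoint [A].  If
   [p <= A <= q], then [(A - p)(q - A) >= 0], which replaces the Cauchy-Schwarz
   inequality for positive forms throughout.  And a real polynomial [p] that is
   nonnegative on the spectrum satisfies [p(A) >= 0]. *)

(** * Inner products and quadratic forms *)

Section InnerProduct.
Context {R : realType} {H : hilbertType R}.
Implicit Types (x y z : H) (a : R[i]) (r : R).

(** Why a quadratic: positive maps need not be multiplicative, so [Phi_i (g (A_i))] has no direct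
    link with [g] of the sum unless [g] is affine, and for squares the discrepancy is exactly what
    [K] records. Subtracting [alpha / 2 * t ^+ 2] from [f] leaves a convex function, which lies
    below its chord; adding the square back to the chord gives [q]. Agreement at both endpoints
    makes [q(a) + q(b)] equal [psi(M) + psi(m)], the constant in the mean for [psi].

    Why quadratic forms: positive maps transport bounds [p <= A <= q], not spectra. Spectral
    hypotheses are therefore turned into bounds on the real form [qf], pushed through the maps, and
    turned back into spectral inclusions when a functional calculus or operator monotonicity
    requires them. Taking [nsq], [qf] and [nrm] with values in [R] instead of [R[i]] leaves
    inequalities in an ordered real field. *)

Definition nsq x : R := complex.Re (inner x x).

Lemma innerDl x y z : inner (x + y) z = inner x z + inner y z.
Proof. by have := inner_linearl 1 x y z; rewrite scale1r mul1r. Qed.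

Lemma inner0l z : inner 0 z = 0 :> R[i].
Proof. by apply: (@addrI _ (inner 0 z)); rewrite -innerDl !addr0. Qed.

Lemma innerZl a x z : inner (a *: x) z = a * inner x z.
Proof. by have := inner_linearl a x 0 z; rewrite addr0 inner0l addr0. Qed.

Lemma innerNl x z : inner (- x) z = - inner x z.
Proof. by rewrite -scaleN1r innerZl mulN1r. Qed.

Lemma innerDr x y z : inner x (y + z) = inner x y + inner x z.
Proof. by rewrite inner_conj innerDl rmorphD /= -!inner_conj. Qed.

Lemma innerZr a x z : inner x (a *: z) = conjc a * inner x z.
Proof. by rewrite inner_conj innerZl rmorphM /= -inner_conj. Qed.

Lemma innerZRr r x z : inner x (r%:C *: z) = r%:C * inner x z.
Proof. by rewrite innerZr conjc_real. Qed.

Lemma innerNr x z : inner x (- z) = - inner x z.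
Proof. by rewrite inner_conj innerNl rmorphN /= -inner_conj. Qed.

Definition innerE := (innerDl, innerDr, innerNl, innerNr, innerZl, innerZRr).

Lemma nsqE x : inner x x = (nsq x)%:C.
Proof.
by rewrite /nsq RRe_real // inner_normE realX // normr_real.
Qed.

Lemma sqr_normE x : `|x| ^+ 2 = (nsq x)%:C.
Proof. by rewrite -inner_normE nsqE. Qed.

Lemma nsq_ge0 x : 0 <= nsq x.
Proof. by rewrite -ler0c -sqr_normE exprn_ge0. Qed.

Lemma nsq_eq0 x : nsq x = 0 -> x = 0.
Proof.
move=> x0; apply/eqP; rewrite -normr_eq0 -sqrf_eq0.
by rewrite sqr_normE x0.
Qed.

Lemma nsq0 : nsq (0 : H) = 0.
Proof. by rewrite /nsq inner0l. Qed.

Lemma le_norm_nsq r x y : 0 <= r ->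
  (`|x| <= r%:C * `|y|) = (nsq x <= r ^+ 2 * nsq y).
Proof.
move=> r0; rewrite -(@ler_pXn2r _ 2) ?nnegrE ?mulr_ge0 ?ler0c //.
by rewrite exprMn !sqr_normE -rmorphXn -rmorphM lecR.
Qed.

Lemma nsqN x : nsq (- x) = nsq x.
Proof. by rewrite /nsq !innerE opprK. Qed.

Lemma re_innerC x y : complex.Re (inner x y) = complex.Re (inner y x).
Proof. by rewrite (inner_conj y x); case: (inner y x). Qed.

Lemma ReD (u v : R[i]) : complex.Re (u + v) = complex.Re u + complex.Re v.
Proof. by case: u; case: v. Qed.

Lemma ReZ r (u : R[i]) : complex.Re (r%:C * u) = r * complex.Re u.
Proof. by case: u => u v /=; rewrite mul0r subr0. Qed.

Lemma nsqZ r x : nsq (r%:C *: x) = r ^+ 2 * nsq x.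
Proof. by rewrite /nsq !innerE mulrA -rmorphM ReZ. Qed.

Lemma nsqD x y : nsq (x + y) = nsq x + 2 * complex.Re (inner x y) + nsq y.
Proof. by rewrite /nsq !innerE !ReD (re_innerC y x); lra. Qed.

End InnerProduct.

Section QuadraticForm.
Context {R : realType} {H : hilbertType R}.
Implicit Types (x y : H) (r : R) (A B C : 'B(H)).

Definition qf A x : R := complex.Re (inner (A x) x).

Lemma bopDE A B x : (A + B) x = A x + B x. Proof. by []. Qed.
Lemma bopNE A x : (- A) x = - A x. Proof. by []. Qed.
Lemma bopZE (a : R[i]) A x : (a *: A) x = a *: A x. Proof. by []. Qed.
Lemma bopME A B x : (A * B) x = A (B x). Proof. by []. Qed.
Lemma bop1E x : (1 : 'B(H)) x = x. Proof. by []. Qed.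
Lemma bop0E x : (0 : 'B(H)) x = 0. Proof. by []. Qed.
Definition bopE := (bopDE, bopNE, bopZE, bopME, bop1E, bop0E).

Lemma bop_sumE I (s : seq I) (P : pred I) (F : I -> 'B(H)) x :
  (\sum_(i <- s | P i) F i) x = \sum_(i <- s | P i) F i x.
Proof. by elim/big_rec2: _ => // i y1 y2 _ <-. Qed.

Lemma bopvD A x y : A (x + y) = A x + A y.
Proof. by have := bop_linear A 1 x y; rewrite !scale1r. Qed.

Lemma bopv0 A : A 0 = 0.
Proof. by apply: (@addrI _ (A 0)); rewrite -bopvD !addr0. Qed.

Lemma bopvZ A a x : A (a *: x) = a *: A x.
Proof. by have := bop_linear A a x 0; rewrite bopv0 !addr0. Qed.

Lemma bopvN A x : A (- x) = - A x.
Proof. by rewrite -scaleN1r bopvZ scaleN1r. Qed.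

Definition bopvE := (bopvD, bopvN, bopvZ, bopv0).

Lemma bopZMl (a : R[i]) A B : (a *: A) * B = a *: (A * B).
Proof. exact: bop_ext. Qed.

Lemma bopZMr (a : R[i]) A B : A * (a *: B) = a *: (A * B).
Proof. by apply: bop_ext => x; rewrite !bopE bopvE. Qed.

Lemma qfD A B x : qf (A + B) x = qf A x + qf B x.
Proof. by rewrite /qf bopE innerE ReD. Qed.
Lemma qfZ r A x : qf (r%:C *: A) x = r * qf A x.
Proof. by rewrite /qf bopE innerE ReZ. Qed.
Lemma qfN A x : qf (- A) x = - qf A x.
Proof. by rewrite /qf bopE innerE; case: (inner _ _). Qed.
Lemma qf1 x : qf 1 x = nsq x. Proof. by []. Qed.
Lemma qf0 x : qf 0 x = 0. Proof. by rewrite /qf bopE inner0l. Qed.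
Definition qfE := (qfD, qfN, qfZ, qf1, qf0).

Lemma sa0 : selfadjoint (0 : 'B(H)).
Proof. by move=> x y; rewrite !bopE (inner_conj 0 x) !inner0l conjc0. Qed.
Lemma sa1 : selfadjoint (1 : 'B(H)).
Proof. by move=> x y. Qed.
Lemma saD A B : selfadjoint A -> selfadjoint B -> selfadjoint (A + B).
Proof. by move=> sA sB x y; rewrite !bopE !innerE sA sB. Qed.
Lemma saN A : selfadjoint A -> selfadjoint (- A).
Proof. by move=> sA x y; rewrite !bopE !innerE sA. Qed.
Lemma saZ r A : selfadjoint A -> selfadjoint (r%:C *: A).
Proof. by move=> sA x y; rewrite !bopE !innerE sA. Qed.
Lemma saB A B : selfadjoint A -> selfadjoint B -> selfadjoint (A - B).
Proof. by move=> sA sB; apply/saD/saN. Qed.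
Lemma saX A n : selfadjoint A -> selfadjoint (A ^+ n).
Proof.
move=> sA; elim: n => [|n IHn] x y; first exact: sa1.
by rewrite {1}exprS exprSr !bopE sA IHn.
Qed.
Lemma sa_sum I (s : seq I) (P : pred I) (F : I -> 'B(H)) :
  (forall i, P i -> selfadjoint (F i)) ->
  selfadjoint (\sum_(i <- s | P i) F i).
Proof. by move=> sF; elim/big_ind: _ => //; [exact: sa0 | exact: saD]. Qed.

Lemma sa_inner A x : selfadjoint A -> inner (A x) x = (qf A x)%:C.
Proof.
move=> sA; have := inner_conj (A x) x; rewrite -sA /qf.
by case: (inner _ _) => u v [] v0 /=; congr (_ +i* _); lra.
Qed.

(** Polarization over the complex scalars: the form at [x + y] settles the imaginary parts of
    [inner (A x) y] and [inner (A y) x], the form at [x + 'i *: y] their real parts. *)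
Lemma inner_real_sa A :
  (forall x, complex.Im (inner (A x) x) = 0) -> selfadjoint A.
Proof.
move=> rA x y.
have := rA (x + y); have := rA (x + 'i *: y).
rewrite !bopvE !innerDl !innerDr !innerZl !innerZr.
have := rA x; have := rA y.
rewrite (inner_conj (A y) x).
case: (inner (A x) x) => a a'; case: (inner (A y) y) => b b'.
case: (inner (A x) y) => c c'; case: (inner (A y) x) => d d' /=.
move=> -> -> h1 h2; congr (_ +i* _); lra.
Qed.

Lemma posopP A : posop A <-> selfadjoint A /\ forall x, 0 <= qf A x.
Proof.
split=> [pA|[sA pA] x]; last by rewrite sa_inner // ler0c.
split=> [|x]; first by apply: inner_real_sa => x; apply: ger0_Im.
by have := pA x; rewrite lecE => /andP[_].
Qed.

Lemma leopP A B : selfadjoint A -> selfadjoint B ->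
  leop A B <-> forall x, qf A x <= qf B x.
Proof.
move=> sA sB; split=> [/posopP[_ h] x|h].
  by have := h x; rewrite !qfE subr_ge0.
by apply/posopP; split; [exact: saB | move=> x; rewrite !qfE subr_ge0].
Qed.

Lemma bop_bound A : exists2 k : R, 0 < k &
  forall x, nsq (A x) <= k ^+ 2 * nsq x.
Proof.
have [k k0 hk] := bop_bounded A; exists (k + 1); first lra.
move=> x; rewrite -le_norm_nsq; last by lra.
by apply: le_trans (hk x) _; apply: ler_wpM2r => //; rewrite lecR; lra.
Qed.

(** Expand the squared norms of [A x + k x] and [A x - k x], both nonnegative. *)
Lemma norm_qf_le A k x : selfadjoint A -> 0 < k ->
  nsq (A x) <= k ^+ 2 * nsq x -> - (k * nsq x) <= qf A x <= k * nsq x.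
Proof.
move=> sA k0 hk.
have : 0 <= nsq (A x + k%:C *: x) by exact: nsq_ge0.
have : 0 <= nsq (A x + (- k)%:C *: x) by exact: nsq_ge0.
rewrite !nsqD !nsqZ !innerE !ReZ -/(qf A x) => h1 h2.
by apply/andP; split; nra.
Qed.

Lemma sa_bound A : selfadjoint A -> exists2 k : R, 0 < k &
  forall x, - (k * nsq x) <= qf A x <= k * nsq x.
Proof.
by move=> sA; have [k k0 hk] := bop_bound A; exists k => // x; apply: norm_qf_le.
Qed.

(* [(A - p)(q - A) >= 0]: up to the factor [q - p], it is the sum of the
   positive operators [(q - A)(A - p)(q - A)] and [(A - p)(q - A)(A - p)]. *)
Lemma qf_between A p q : selfadjoint A -> p < q ->
  (forall x, p * nsq x <= qf A x <= q * nsq x) ->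
  forall x, nsq (A x) <= (p + q) * qf A x - p * q * nsq x.
Proof.
move=> sA pq hA x.
have ns u v : nsq (u%:C *: x + v%:C *: A x) =
    u ^+ 2 * nsq x + 2 * u * v * qf A x + v ^+ 2 * nsq (A x).
  by rewrite nsqD !nsqZ !innerE !ReZ re_innerC -/(qf A x); ring.
have qs u v : qf A (u%:C *: x + v%:C *: A x) =
    u ^+ 2 * qf A x + 2 * u * v * nsq (A x) + v ^+ 2 * qf A (A x).
  rewrite /qf !bopvE !innerE !ReD !ReZ.
  by rewrite (sA (A x) x) -!/(nsq _); ring.
have /andP[h1 _] := hA (q%:C *: x + (-1)%:C *: A x).
have /andP[_ h2] := hA ((-p)%:C *: x + 1%:C *: A x).
move: h1 h2; rewrite !ns !qs => h1 h2.
rewrite -subr_ge0 -(@pmulr_rge0 _ (q - p)); last by rewrite subr_gt0.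
move: (nsq x) (qf A x) (nsq (A x)) (qf A (A x)) h1 h2 => n b d e h1 h2.
by rewrite -subr_ge0 in h1; rewrite -subr_ge0 in h2; nra.
Qed.

(** With [p = -k] and [q = k] the linear term of [qf_between] cancels. Norm estimates for
    self-adjoint operators are reduced to form estimates through this converse of [norm_qf_le]. *)
Lemma nsq_qf_le A k : selfadjoint A -> 0 < k ->
  (forall x, - (k * nsq x) <= qf A x <= k * nsq x) ->
  forall x, nsq (A x) <= k ^+ 2 * nsq x.
Proof.
move=> sA k0 hA x.
have := @qf_between A (- k) k sA _ _ x.
rewrite addNr mul0r sub0r mulNr mulNr opprK -expr2; apply; first lra.
by move=> z; rewrite mulNr; apply: hA.
Qed.

End QuadraticForm.

(** * Invertibility *)

Section RealNorm.
Context {R : realType} {H : hilbertType R}.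
Implicit Types (x y : H) (r : R).

Definition nrm x : R := complex.Re `|x|.

Lemma nrmE x : `|x| = (nrm x)%:C.
Proof. by rewrite /nrm RRe_real // normr_real. Qed.

Lemma nrm_ge0 x : 0 <= nrm x.
Proof. by rewrite -ler0c -nrmE. Qed.

Lemma nrmD x y : nrm (x + y) <= nrm x + nrm y.
Proof. by rewrite -lecR rmorphD /= -!nrmE ler_normD. Qed.

Lemma nrmN x : nrm (- x) = nrm x.
Proof. by rewrite /nrm normrN. Qed.

Lemma nrm_eq0 x : nrm x = 0 -> x = 0.
Proof. by move=> x0; apply/eqP; rewrite -normr_eq0 nrmE x0. Qed.

Lemma le_nrm_nsq r x y : 0 <= r ->
  (nrm x <= r * nrm y) = (nsq x <= r ^+ 2 * nsq y).
Proof. by move=> r0; rewrite -le_norm_nsq // !nrmE -rmorphM lecR. Qed.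

Lemma nrm_small x (c : R) : (forall e, 0 < e -> nrm x <= e * c) -> x = 0.
Proof.
move=> h; apply/nrm_eq0/eqP; rewrite eq_le nrm_ge0 andbT.
apply/ler_addgt0Pl => e e0; rewrite addr0.
have c1 : 0 < `|c| + 1 by rewrite ltr_wpDl.
apply: le_trans (h (e / (`|c| + 1)) (divr_gt0 e0 c1)) _.
rewrite mulrAC ler_pdivrMr // ler_pM2l //.
by apply: le_trans (ler_norm c) _; rewrite lerDl.
Qed.

(** Balls of [H] have radii in [R[i]], but a positive radius there is real, so real [e] suffice. *)
Lemma cauchy_nrm_cvg (v : nat -> H) :
  (forall e, 0 < e -> exists N, forall m n, (N <= m)%N -> (N <= n)%N ->
     nrm (v m - v n) <= e) ->
  exists l : H, v @ \oo --> l.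
Proof.
move=> hv; suff : cvg (v @ \oo) by move=> /cvg_ex[l]; exists l.
apply/cauchy_cvgP/cauchy_ballP => e e0.
have re0 : 0 < complex.Re e by move: e0; rewrite ltcE => /andP[].
have eE : e = (complex.Re e)%:C by rewrite RRe_real // gtr0_real.
have [N hN] := hv _ (divr_gt0 re0 (ltr0n _ 2)).
pose E : set H := v @` [set n | (N <= n)%N].
have vE : (v @ \oo) E by exists N => // n /= hn; exists n.
exists (E, E) => //= -[x y] /= [[m hm <-] [n hn <-]].
rewrite -ball_normE /= nrmE eE ltcR.
apply: le_lt_trans (hN _ _ hm hn) _.
by rewrite ltr_pdivrMr // mulr_natr mulr2n ltrDl.
Qed.

Lemma cvg_nrm (v : nat -> H) l : v @ \oo --> l ->
  forall e, 0 < e -> exists n0, forall n, (n0 <= n)%N -> nrm (v n - l) <= e.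
Proof.
move=> vl e e0; have e0' : 0 < e%:C :> R[i] by rewrite ltcR.
have /cvgrPdistC_le /(_ _ e0') [n0 _ h] := vl.
by exists n0 => n /h /=; rewrite nrmE lecR.
Qed.

End RealNorm.

(** * Operator-norm limits and the Neumann series *)

Section Limits.
Context {R : realType} {H : hilbertType R}.
Implicit Types (A B C : 'B(H)).

(** Completeness in operator norm, stated with rates. Pointwise limits exist because [H] is
    complete; in the bound [d m + d n], letting [m] grow leaves exactly [d n], uniformly in [x],
    which also makes the limit bounded. *)
Lemma bop_limit (u : nat -> 'B(H)) (d : nat -> R) :
  (forall e, 0 < e -> exists N, forall n, (N <= n)%N -> d n <= e) ->
  (forall m n x, nrm (u m x - u n x) <= (d m + d n) * nrm x) ->
  exists B : 'B(H), forall n x, nrm (u n x - B x) <= d n * nrm x.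
Proof.
move=> d0 ud.
have cv x : exists l : H, u ^~ x @ \oo --> l.
  apply: cauchy_nrm_cvg => e e0.
  have n1 : 0 < 2 * (nrm x + 1) by rewrite mulr_gt0 // ltr_wpDl ?nrm_ge0.
  have [N hN] := d0 _ (divr_gt0 e0 n1).
  exists N => m n hm hn; apply: le_trans (ud m n x) _.
  have hm' := hN _ hm; have hn' := hN _ hn.
  apply: le_trans (_ : (e / (nrm x + 1)) * nrm x <= _); last first.
    by rewrite mulrAC ler_pdivrMr ?ltr_wpDl ?nrm_ge0 // ler_pM2l // lerDl.
  apply: ler_wpM2r; first exact: nrm_ge0.
  apply: le_trans (lerD hm' hn') _.
  by rewrite invfM mulrCA; lra.
pose B x := sval (cid (cv x)).
have BP x : u ^~ x @ \oo --> B x by rewrite /B; case: cid.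
have lB : linear B.
  move=> a x y; have := BP (a *: x + y).
  have -> : u ^~ (a *: x + y) = (fun n => a *: u n x + u n y).
    by apply/funext => n; rewrite bop_linear.
  move=> h; apply: (cvg_unique _ h); first exact: norm_hausdorff.
  by apply: cvgD; [apply: cvgZr|].
have Bd n x : nrm (u n x - B x) <= d n * nrm x.
  apply/ler_addgt0Pr => e e0.
  have e2 : 0 < e / 2 by lra.
  have n1 : 0 < 2 * (nrm x + 1) by rewrite mulr_gt0 // ltr_wpDl ?nrm_ge0.
  have [N hN] := d0 _ (divr_gt0 e0 n1).
  have [N' hN'] := cvg_nrm (BP x) e2.
  pose m := maxn N N'.
  have hm := hN' m (leq_maxr _ _); have dm := hN m (leq_maxl _ _).
  have -> : u n x - B x = (u n x - u m x) + (u m x - B x) by rewrite addrA subrK.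
  apply: le_trans (nrmD _ _) _.
  have h1 := ud n m x.
  have h2 : d m * nrm x <= e / 2.
    apply: le_trans (ler_wpM2r (nrm_ge0 _) dm) _.
    rewrite invfM mulrA mulrAC ler_pdivrMr ?ltr_wpDl ?nrm_ge0 //.
    by rewrite ler_pM2l // lerDl.
  by rewrite mulrDl in h1; lra.
have BB : B \in bop_pred.
  apply/bop_predP; split=> //.
  have [k k0 hk] := bop_bound (u 0%N); exists (k + d 0%N) => x.
  rewrite !nrmE -rmorphM lecR mulrDl.
  have -> : B x = u 0%N x + - (u 0%N x - B x) by rewrite opprB addrC subrK.
  apply: le_trans (nrmD _ _) _; rewrite nrmN; apply: lerD (Bd _ _).
  by rewrite le_nrm_nsq // ltW.
by exists (Bop BB).
Qed.

Lemma expr_small (r : R) : 0 <= r -> r < 1 ->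
  forall e, 0 < e -> exists N, forall n, (N <= n)%N -> r ^+ n <= e.
Proof.
move=> r0 r1 e e0.
have : (fun n => r ^+ n) @ \oo --> (0 : R) by apply: cvg_expr; rewrite ger0_norm.
move=> /cvgrPdistC_le /(_ _ e0) [N _ h].
by exists N => n /h /=; rewrite subr0 ger0_norm // exprn_ge0.
Qed.

(** Neumann series: the partial sums [u n] converge at the rate [r ^+ n / (1 - r)], and [u n] times
    [1 - A], in either order, is [1 - A ^+ n]. *)
Lemma invertible_sub1 A (r : R) : 0 <= r -> r < 1 ->
  (forall x, nrm (A x) <= r * nrm x) -> invertible (1 - A).
Proof.
move=> r0 r1 Ar.
have AX n x : nrm ((A ^+ n) x) <= r ^+ n * nrm x.
  elim: n => [|n IHn]; first by rewrite !expr0 mul1r.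
  rewrite (exprS A) (exprS r) bopME -mulrA; apply: le_trans (Ar _) _.
  exact: ler_wpM2l.
have r1' : 0 < 1 - r by lra.
pose u n := \sum_(i < n) A ^+ i.
have uS n : u n.+1 = u n + A ^+ n by rewrite /u big_ord_recr.
(* The bound is the exact value of the geometric sum, so the induction on [k] closes with an
   equality of coefficients. *)
have uu n k x : nrm (u (n + k)%N x - u n x) <=
    (r ^+ n - r ^+ (n + k)) / (1 - r) * nrm x.
  elim: k => [|k IHk].
    by rewrite addn0 !subrr /nrm normr0 !mul0r.
  rewrite addnS uS bopDE addrAC.
  apply: le_trans (nrmD _ _) _.
  apply: le_trans (lerD IHk (AX _ _)) _.
  rewrite -mulrDl; apply: ler_wpM2r; first exact: nrm_ge0.
  rewrite exprS le_eqVlt; apply/orP; left; apply/eqP; field; lra.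
pose d n := r ^+ n / (1 - r).
have d0 e : 0 < e -> exists N, forall n, (N <= n)%N -> d n <= e.
  move=> e0; have [N hN] := expr_small r0 r1 (mulr_gt0 e0 r1').
  by exists N => n /hN; rewrite /d ler_pdivrMr.
have ud m n x : nrm (u m x - u n x) <= (d m + d n) * nrm x.
  wlog mn : m n / (n <= m)%N.
    move=> h; have /orP[|] := leq_total n m => nm; first exact: h.
    by rewrite -opprB nrmN (addrC (d m)); apply: h.
  rewrite -(subnKC mn); apply: le_trans (uu _ _ _) _.
  apply: ler_wpM2r; first exact: nrm_ge0.
  rewrite /d -mulrDl; apply: ler_wpM2r; first by rewrite invr_ge0 ltW.
  by rewrite addrC lerD2r; apply: le_trans (_ : 0 <= _);
    rewrite ?oppr_le0 ?exprn_ge0.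
have [B hB] := bop_limit d0 ud.
have uA n : u n * (1 - A) = 1 - A ^+ n.
  elim: n => [|n IHn]; first by rewrite /u big_ord0 mul0r expr0 subrr.
  rewrite uS mulrDl IHn mulrBr mulr1 -exprSr.
  by rewrite addrA subrK.
have Au n : (1 - A) * u n = 1 - A ^+ n.
  elim: n => [|n IHn]; first by rewrite /u big_ord0 mulr0 expr0 subrr.
  rewrite uS mulrDr IHn mulrBl mul1r -exprS.
  by rewrite addrA subrK.
exists B; split; apply: bop_ext => x; apply/eqP; rewrite -subr_eq0; apply/eqP.
(* Since [r < 1], applying [1 - A] at most doubles the error of [u n x], hence [2 * nrm x]; the
   other [nrm x] pays for the remainder [A ^+ n]. *)
- apply: (@nrm_small _ _ _ (2 * nrm x + nrm x)) => e e0.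
  have [N hN] := d0 _ e0; have [N' hN'] := expr_small r0 r1 e0.
  pose n := maxn N N'.
  have h1 := hN n (leq_maxl _ _); have h2 := hN' n (leq_maxr _ _).
  have -> : ((1 - A) * B) x - (1 : 'B(H)) x =
    - ((1 - A) (u n x - B x)) - (A ^+ n) x.
    have e1 : (1 - A) (u n x) = x - (A ^+ n) x by rewrite -bopME Au.
    rewrite bopvD bopvN e1 opprD opprK opprB bop1E -bopME.
    move: (((1 - A) * B) x) ((A ^+ n) x) => z a.
    by rewrite [RHS]addrAC [a - x]addrC addrK addrC.
  apply: le_trans (nrmD _ _) _; rewrite !nrmN mulrDr; apply: lerD; last first.
    by apply: le_trans (AX _ _) _; apply: ler_wpM2r => //; exact: nrm_ge0.
  rewrite !bopE; apply: le_trans (nrmD _ _) _; rewrite nrmN.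
  have := Ar (u n x - B x); have := hB n x; have := nrm_ge0 (u n x - B x).
  by have := nrm_ge0 x; move: (nrm (A _)) => z; nra.
- apply: (@nrm_small _ _ _ (nrm ((1 - A) x) + nrm x)) => e e0.
  have [N hN] := d0 _ e0; have [N' hN'] := expr_small r0 r1 e0.
  pose n := maxn N N'.
  have h1 := hN n (leq_maxl _ _); have h2 := hN' n (leq_maxr _ _).
  have -> : (B * (1 - A)) x - (1 : 'B(H)) x =
    - (u n ((1 - A) x) - B ((1 - A) x)) - (A ^+ n) x.
    have e1 : u n ((1 - A) x) = x - (A ^+ n) x by rewrite -bopME uA.
    rewrite e1 opprB bop1E bopME.
    move: (B ((1 - A) x)) ((A ^+ n) x) => z a.
    by rewrite opprB addrA [RHS]addrAC addrK.
  apply: le_trans (nrmD _ _) _; rewrite !nrmN mulrDr; apply: lerD.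
    by apply: le_trans (hB _ _) _; apply: ler_wpM2r => //; exact: nrm_ge0.
  by apply: le_trans (AX _ _) _; apply: ler_wpM2r => //; exact: nrm_ge0.
Qed.

Lemma invertibleZ (a : R[i]) A : a != 0 -> invertible A -> invertible (a *: A).
Proof.
move=> a0 [B [AB BA]]; exists (a^-1 *: B).
by rewrite !bopZMl !bopZMr !scalerA mulfV // mulVf // !scale1r.
Qed.

Lemma invertibleM A B : invertible A -> invertible B -> invertible (A * B).
Proof.
move=> [A' [h1 h2]] [B' [h3 h4]]; exists (B' * A'); split.
  by rewrite mulrA -(mulrA A) h3 mulr1.
by rewrite mulrA -(mulrA B') h2 mulr1.
Qed.

(** If [C] inverts [A * B], then [B * C] is a right inverse of [A] and, by commutation, [C * B] a
    left one; the two must coincide. *)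
Lemma invertible_comm A B : A * B = B * A -> invertible (A * B) -> invertible A.
Proof.
move=> cAB [C [h1 h2]].
have h3 : A * (B * C) = 1 by rewrite mulrA.
have h4 : C * A * B = 1 by rewrite -mulrA.
have e : C * B = B * C.
  transitivity (C * (B * (A * B)) * C); first by rewrite -!mulrA h3 mulr1.
  by rewrite (mulrA B) -cAB !mulrA h4 mul1r.
by exists (B * C); split; [rewrite mulrA | rewrite -e -mulrA -cAB].
Qed.

(** With [l = k + c], where [k] bounds the form of [A], the form of [T = 1 - A / l] lies between
    [c / l] and [k / l < 1]. So [T] is a strict contraction and [A = l (1 - T)] is inverted by the
    Neumann series. *)
Lemma bounded_below_invertible A (c : R) : selfadjoint A -> 0 < c ->
  (forall x, c * nsq x <= qf A x) -> invertible A.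
Proof.
move=> sA c0 Ac; have [k k0 hk] := sa_bound sA.
pose l := k + c; have l0 : 0 < l by rewrite /l; lra.
pose T : 'B(H) := 1 - (l^-1)%:C *: A.
have sT : selfadjoint T by apply/saB/saZ/sA; exact: sa1.
have -> : A = l%:C *: (1 - T).
  rewrite /T opprB addrC subrK scalerA -rmorphM mulfV ?gt_eqF //.
  by rewrite scale1r.
apply: invertibleZ; first by rewrite eq_complex /= eqxx andbT gt_eqF.
have r0 : 0 < k / l by rewrite divr_gt0.
have r1 : k / l < 1 by rewrite ltr_pdivrMr // mul1r /l; lra.
apply: (@invertible_sub1 _ (k / l)) => //; first exact: ltW.
move=> x; rewrite le_nrm_nsq ?(ltW r0) //; apply: nsq_qf_le => // z.
have /andP[h1 h2] := hk z; have h3 := Ac z; have n0 := nsq_ge0 z.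
rewrite !qfE; have e : 1 - k / l = c / l by rewrite /l; field; rewrite -/l gt_eqF.
have h4 : l^-1 * qf A z <= l^-1 * (k * nsq z) by rewrite ler_pM2l ?invr_gt0.
have h5 : l^-1 * (c * nsq z) <= l^-1 * qf A z by rewrite ler_pM2l ?invr_gt0.
have h6 : 0 <= k / l * nsq z by rewrite mulr_ge0 // ltW.
apply/andP; split.
  rewrite mulrCA mulrA in h4.
  have : 0 <= c / l * nsq z by rewrite mulr_ge0 // divr_ge0 // ltW.
  by rewrite -e mulrBl mul1r => h7; lra.
have -> : k / l = 1 - c / l by rewrite -e; lra.
by rewrite mulrCA mulrA in h5; lra.
Qed.

(** For [S = A - Re z] and [t = Im z], the commuting factors [S - i t] and [S + i t] have product
    [S ^+ 2 + t ^+ 2], bounded below by [t ^+ 2 > 0]. *)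
Lemma nonreal_invertible A (z : R[i]) : selfadjoint A -> complex.Im z != 0 ->
  invertible (A - z *: (1 : 'B(H))).
Proof.
case: z => s t /= sA t0; pose S := A - s%:C *: (1 : 'B(H)).
have sS : selfadjoint S by apply/saB/saZ/sa1.
have e1 : A - (s +i* t) *: (1 : 'B(H)) = S - (t *i) *: (1 : 'B(H)).
  have -> : s +i* t = s%:C + t *i.
    by apply/eqP; rewrite eq_complex /= addr0 add0r !eqxx.
  by rewrite scalerDl opprD addrA.
rewrite e1; clearbody S; pose Q := S + (t *i) *: (1 : 'B(H)).
pose c : R[i] := t *i; rewrite -/c.
have cS : S * (c *: (1 : 'B(H))) = c *: S by rewrite bopZMr mulr1.
have Sc : (c *: (1 : 'B(H))) * S = c *: S by rewrite bopZMl mul1r.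
have cc : (c *: (1 : 'B(H))) * (c *: (1 : 'B(H))) = - (t ^+ 2)%:C *: (1 : 'B(H)).
  rewrite bopZMl mul1r scalerA; congr (_ *: _).
  by apply/eqP; rewrite eq_complex /= expr2; apply/andP; split; apply/eqP; ring.
have PQ : (S - c *: (1 : 'B(H))) * Q = S ^+ 2 + (t ^+ 2)%:C *: (1 : 'B(H)).
  by rewrite /Q mulrDr !mulrBl cS Sc cc scaleNr opprK subrKA expr2.
have QP : Q * (S - c *: (1 : 'B(H))) = S ^+ 2 + (t ^+ 2)%:C *: (1 : 'B(H)).
  by rewrite /Q mulrBr !mulrDl cS Sc cc scaleNr opprD opprK addrA addrK expr2.
apply: (@invertible_comm _ Q); first by rewrite PQ QP.
rewrite PQ; apply: (@bounded_below_invertible _ (t ^+ 2)).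
- by apply/saD; [exact: saX | apply/saZ/sa1].
- by rewrite exprn_even_gt0.
- move=> x; rewrite !qfE lerDr expr2 /qf bopE sS -/(nsq _).
  exact: nsq_ge0.
Qed.

End Limits.

(** * Spectrum and polynomials of operators *)

Section Spectrum.
Context {R : realType} {H : hilbertType R}.
Implicit Types (A B C : 'B(H)) (p q : {poly R}).

(* If [mu < 0] is the infimum of the numerical range, then [C := A - mu] is
   positive and satisfies [C^2 <= k C]; were it invertible, it would be bounded
   below by some [delta > 0], so that [mu + delta] would also be a lower bound. *)
Lemma qf_ge0_of_spectrum A : selfadjoint A ->
  (forall l : R, l < 0 -> invertible (A - l%:C *: (1 : 'B(H)))) ->
  forall x, 0 <= qf A x.
Proof.
move=> sA iA x0; rewrite leNgt; apply/negP => Ax0.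
have [k k0 hk] := sa_bound sA.
(* The cap [l <= 0] bounds [E] above at once. It loses nothing, since [x0] forces [mu < 0], and it
   is why the element that contradicts the supremum is [Num.min 0 (mu + delta)]. *)
pose E : set R := [set l | l <= 0 /\ forall x, l * nsq x <= qf A x].
have Ek : E (- k).
  by split=> [|x]; [rewrite oppr_le0 ltW | have /andP[] := hk x; rewrite mulNr].
have hE : has_sup E by split; [exists (- k) | exists 0 => l []].
pose mu := sup E.
have muA x : mu * nsq x <= qf A x.
  have [n0|n0] := ltrP 0 (nsq x); last first.
    have x00 : x = 0 by apply/nsq_eq0/eqP; rewrite eq_le n0 nsq_ge0.
    by rewrite x00 nsq0 mulr0 /qf bopv0 inner0l.
  rewrite -ler_pdivlMr //; apply: ge_sup; first by exists (- k).
  by move=> l [_ /(_ x)]; rewrite ler_pdivlMr.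
have mu0 : mu < 0.
  rewrite ltNge; apply/negP => mu0; have := muA x0; have := nsq_ge0 x0.
  by move=> n0 h; have := mulr_ge0 mu0 n0; lra.
pose C := A - mu%:C *: (1 : 'B(H)).
have sC : selfadjoint C by apply/saB/saZ/sa1.
have [D [_ DC]] : invertible C := iA _ mu0.
have [k1 k10 hk1] := bop_bound D.
pose L := k - mu; have L0 : 0 < L by rewrite /L; lra.
have qC x : qf C x = qf A x - mu * nsq x by rewrite /C !qfE.
have bC x : 0 * nsq x <= qf C x <= L * nsq x.
  have := muA x; have /andP[_ h] := hk x.
  by rewrite qC mul0r /L => h'; apply/andP; split; lra.
have nC x : nsq (C x) <= L * qf C x.
  by have := qf_between sC L0 bC x; rewrite add0r !mul0r subr0.
have nx x : nsq x <= k1 ^+ 2 * L * qf C x.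
  have {1}-> : x = D (C x) by rewrite -bopME DC.
  apply: le_trans (hk1 _) _; rewrite -mulrA; apply: ler_wpM2l (nC x).
  exact: sqr_ge0.
pose delta := (k1 ^+ 2 * L)^-1.
have d0 : 0 < k1 ^+ 2 * L by rewrite mulr_gt0 // exprn_gt0.
have : E (Num.min 0 (mu + delta)).
  split=> [|x]; first by rewrite ge_min lexx.
  have : Num.min 0 (mu + delta) * nsq x <= (mu + delta) * nsq x.
    by apply: ler_wpM2r; [exact: nsq_ge0 | rewrite ge_min lexx orbT].
  move=> /le_trans; apply; rewrite mulrDl -lerBrDl -qC.
  by rewrite /delta mulrC ler_pdivrMr // mulrC.
move=> /(ub_le_sup hE.2); rewrite -/mu ge_min => /orP[|]; first lra.
by rewrite gerDl leNgt invr_gt0 d0.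
Qed.

Lemma spectrum_real A z : selfadjoint A -> spectrum A z ->
  z = (complex.Re z)%:C.
Proof.
move=> sA zA; have [z0|z0] := eqVneq (complex.Im z) 0.
  by case: z z0 {zA} => u v /= ->.
by exfalso; apply: zA; exact: nonreal_invertible.
Qed.

(** Apply [qf_ge0_of_spectrum] to [A - a] and [b - A]: a negative number in either spectrum would
    come from a point of the spectrum of [A] outside the interval. With its converse
    [qf_spectrum_in], this trades spectral inclusions for form bounds. *)
Lemma spectrum_in_qf A (a b : R) : selfadjoint A -> spectrum_in A `[a, b] ->
  forall x, a * nsq x <= qf A x <= b * nsq x.
Proof.
move=> sA Aab.
have inv t : ~ `[a, b]%classic t -> invertible (A - t%:C *: (1 : 'B(H))).
  by move=> tab; apply: contrapT => /Aab[s sab [st]]; rewrite -st in tab.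
have shift (c : R) (s : R) B : A - (c + s)%:C *: (1 : 'B(H)) =
    (A - c%:C *: (1 : 'B(H))) - s%:C *: (1 : 'B(H)).
  by rewrite rmorphD /= scalerDl opprD addrA.
move=> x; apply/andP; split.
  have := @qf_ge0_of_spectrum (A - a%:C *: (1 : 'B(H))) _ _ x.
  rewrite !qfE subr_ge0; apply; first by apply/saB/saZ/sa1.
  move=> l l0; rewrite -shift //; apply: inv.
  by rewrite /= in_itv /= => /andP[]; lra.
have := @qf_ge0_of_spectrum (b%:C *: (1 : 'B(H)) - A) _ _ x.
rewrite !qfE subr_ge0; apply; first by apply/saB/sA/saZ/sa1.
move=> l l0.
have -> : b%:C *: (1 : 'B(H)) - A - l%:C *: (1 : 'B(H)) =
    (-1)%:C *: (A - (b - l)%:C *: (1 : 'B(H))).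
  rewrite rmorphB rmorphN1 /= scaleN1r opprB scalerBl.
  by rewrite addrAC.
apply: invertibleZ; first by rewrite eq_complex /= eqxx andbT oppr_eq0 oner_eq0.
by apply: inv; rewrite /= in_itv /= => /andP[]; lra.
Qed.

Lemma qf_spectrum_in A (a b : R) : selfadjoint A ->
  (forall x, a * nsq x <= qf A x <= b * nsq x) -> spectrum_in A `[a, b].
Proof.
move=> sA Aab z zA; exists (complex.Re z); last by rewrite -(spectrum_real sA zA).
have := zA; rewrite (spectrum_real sA zA).
set t := complex.Re z => tA; rewrite /= in_itv /= !leNgt.
apply/andP; split; apply/negP => ht; apply: tA.
  apply: (@bounded_below_invertible _ _ _ (a - t)).
  - by apply/saB/saZ/sa1.
  - by rewrite subr_gt0.
  - by move=> x; rewrite !qfE mulrBl lerD2r; have /andP[] := Aab x.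
have -> : A - t%:C *: (1 : 'B(H)) = (-1)%:C *: (t%:C *: (1 : 'B(H)) - A).
  by rewrite rmorphN1 scaleN1r opprB.
apply: invertibleZ; first by rewrite eq_complex /= eqxx andbT oppr_eq0 oner_eq0.
apply: (@bounded_below_invertible _ _ _ (t - b)).
- by apply/saB/sA/saZ/sa1.
- by rewrite subr_gt0.
- by move=> x; rewrite !qfE mulrBl lerD2l lerN2; have /andP[] := Aab x.
Qed.

(** Complex coefficients allow a splitting into linear factors; [op_polyE] carries the results back
    to real polynomials. *)
Definition op_cpoly (p : {poly R[i]}) A : 'B(H) := \sum_(i < size p) p`_i *: A ^+ i.

Lemma op_cpoly_widen n (p : {poly R[i]}) A : (size p <= n)%N ->
  op_cpoly p A = \sum_(i < n) p`_i *: A ^+ i.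
Proof.
move=> pn; rewrite /op_cpoly (big_ord_widen n (fun i => p`_i *: A ^+ i) pn).
rewrite big_mkcond; apply: eq_bigr => i _; case: ltnP => // ip.
by rewrite nth_default // scale0r.
Qed.

Lemma op_cpolyD (p q : {poly R[i]}) A :
  op_cpoly (p + q) A = op_cpoly p A + op_cpoly q A.
Proof.
pose n := maxn (size p) (size q).
rewrite (@op_cpoly_widen n (p + q)) ?size_polyD //.
rewrite (@op_cpoly_widen n p) ?leq_maxl //.
rewrite (@op_cpoly_widen n q) ?leq_maxr // -big_split; apply: eq_bigr => i _.
by rewrite coefD scalerDl.
Qed.

Lemma op_cpolyZ c (p : {poly R[i]}) A : op_cpoly (c *: p) A = c *: op_cpoly p A.
Proof.
rewrite (@op_cpoly_widen (size p)) ?size_scale_leq // /op_cpoly scaler_sumr.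
by apply: eq_bigr => i _; rewrite coefZ scalerA.
Qed.

Lemma op_cpolyC c A : op_cpoly c%:P A = c *: (1 : 'B(H)).
Proof.
by rewrite (@op_cpoly_widen 1) ?size_polyC_leq1 // big_ord1 coefC expr0.
Qed.

Lemma op_cpolyMX (p : {poly R[i]}) A : op_cpoly (p * 'X) A = op_cpoly p A * A.
Proof.
rewrite (@op_cpoly_widen (size p).+1); last first.
  by have [->|p0] := eqVneq p 0; rewrite ?mul0r ?size_poly0 ?size_mulX.
rewrite big_ord_recl coefMX eqxx scale0r add0r /op_cpoly mulr_suml.
by apply: eq_bigr => i _; rewrite coefMX /= exprSr bopZMl.
Qed.

Lemma op_cpoly_comm (p : {poly R[i]}) A : op_cpoly p A * A = A * op_cpoly p A.
Proof.
rewrite /op_cpoly mulr_suml mulr_sumr; apply: eq_bigr => i _.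
by rewrite bopZMl bopZMr -exprS -exprSr.
Qed.

Lemma op_cpolyM (p q : {poly R[i]}) A :
  op_cpoly (p * q) A = op_cpoly p A * op_cpoly q A.
Proof.
elim/poly_ind: p => [|p c IHp].
  by rewrite mul0r -(scale0r 0) op_cpolyZ scale0r mul0r.
rewrite mulrDl mulrAC mul_polyC !op_cpolyD op_cpolyZ !op_cpolyMX IHp.
rewrite op_cpolyC mulrDl.
by rewrite -!mulrA op_cpoly_comm bopZMl mul1r.
Qed.

(** One half of the spectral mapping theorem: [p(A)] is a nonzero scalar times a product of factors
    [A - z], one for each root. *)
Lemma op_cpoly_invertible (p : {poly R[i]}) A : p != 0 ->
  (forall z, root p z -> invertible (A - z *: (1 : 'B(H)))) ->
  invertible (op_cpoly p A).
Proof.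
have [s ->] := closed_field_poly_normal p.
set c := lead_coef p; move=> p0 hA.
have c0 : c != 0 by apply: contraNneq p0 => ->; rewrite scale0r.
rewrite op_cpolyZ; apply: invertibleZ => //.
have {}hA z : z \in s -> invertible (A - z *: (1 : 'B(H))).
  by move=> zs; apply: hA; rewrite rootZ // root_prod_XsubC.
elim: s {p0} hA => [|z s IHs] hA.
  by rewrite big_nil -[1]/(1%:P) op_cpolyC scale1r; exists 1; rewrite mulr1.
rewrite big_cons op_cpolyM; apply: invertibleM; last first.
  by apply: IHs => y ys; apply: hA; rewrite inE ys orbT.
rewrite op_cpolyD -polyCN op_cpolyC -['X]mul1r op_cpolyMX.
rewrite -[1]/(1%:P) op_cpolyC scale1r mul1r scaleNr.
by apply: hA; rewrite mem_head.
Qed.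

Notation toC := (map_poly (real_complex R)).

Lemma op_polyE p A : op_poly p A = op_cpoly (toC p) A.
Proof.
rewrite /op_poly /op_cpoly size_map_poly.
by apply: eq_bigr => i _; rewrite coef_map.
Qed.

Lemma op_polyD p q A : op_poly (p + q) A = op_poly p A + op_poly q A.
Proof. by rewrite !op_polyE rmorphD /= op_cpolyD. Qed.
Lemma op_polyZ (c : R) p A : op_poly (c *: p) A = c%:C *: op_poly p A.
Proof. by rewrite !op_polyE map_polyZ op_cpolyZ. Qed.
Lemma op_polyN p A : op_poly (- p) A = - op_poly p A.
Proof. by rewrite -scaleN1r op_polyZ rmorphN1 scaleN1r. Qed.
Lemma op_polyC (c : R) A : op_poly c%:P A = c%:C *: (1 : 'B(H)).
Proof. by rewrite !op_polyE map_polyC op_cpolyC. Qed.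
Lemma op_polyM p q A : op_poly (p * q) A = op_poly p A * op_poly q A.
Proof. by rewrite !op_polyE rmorphM /= op_cpolyM. Qed.
Lemma op_polyX A : op_poly 'X A = A.
Proof.
rewrite op_polyE map_polyX -['X]mul1r op_cpolyMX.
by rewrite -[1]/(1%:P) op_cpolyC scale1r mul1r.
Qed.

Lemma sa_op_poly p A : selfadjoint A -> selfadjoint (op_poly p A).
Proof. by move=> sA; apply: sa_sum => i _; apply/saZ/saX. Qed.

(* A root of [p - l] with [l < 0] is not a point of the spectrum, so factoring
   [p - l] over the complex numbers shows that [p(A) - l] is invertible. *)
Lemma op_poly_ge0 p A : selfadjoint A ->
  (forall t : R, spectrum A t%:C -> 0 <= p.[t]) ->
  forall x, 0 <= qf (op_poly p A) x.
Proof.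
move=> sA hp; apply: qf_ge0_of_spectrum; first exact: sa_op_poly.
move=> l l0; rewrite -scaleNr -rmorphN -(op_polyC _ A) -op_polyD op_polyE.
have inv (t : R) : p.[t] = l -> invertible (A - t%:C *: (1 : 'B(H))).
  by move=> pt; apply: contrapT => /hp; rewrite pt leNgt l0.
have [pl0|pl0] := eqVneq (p + (- l)%:P) 0; last first.
  apply: op_cpoly_invertible; first by rewrite map_poly_eq0.
  move=> z; have [z0|z0 _] := eqVneq (complex.Im z) 0; last first.
    exact: nonreal_invertible.
  have -> : z = (complex.Re z)%:C by case: z z0 => u v /= ->.
  rewrite fmorph_root rootE !hornerE => /eqP/eqP.
  by rewrite subr_eq0 => /eqP; exact: inv.
(* In the degenerate case [p] is the constant [l < 0], so no real number is in the spectrum. Then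
   [A - (k + 1)] is positive although [A <= k], which forces [H] to be zero, where every operator is
   invertible. *)
have pt t : p.[t] = l.
  apply/eqP; rewrite -subr_eq0.
  by have := congr1 (fun q => q.[t]) pl0; rewrite !hornerE => ->.
have x0 (x : H) : x = 0.
  apply: nsq_eq0; apply/eqP; rewrite eq_le nsq_ge0 andbT.
  have [k k0 hk] := sa_bound sA; have /andP[_ h] := hk x.
  have := @qf_ge0_of_spectrum (A - (k + 1)%:C *: (1 : 'B(H))) _ _ x.
  rewrite !qfE subr_ge0 mulrDl mul1r => h'.
  have : k * nsq x + nsq x <= qf A x; last by lra.
  apply: h'; first by apply/saB/saZ/sa1.
  move=> s _; rewrite -addrA -opprD -scalerDl -rmorphD.
  exact/inv/pt.
by exists 0; split; apply: bop_ext => x; rewrite [LHS]x0 [RHS]x0.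
Qed.

Lemma op_poly_le p A (e : R) : selfadjoint A ->
  (forall t : R, spectrum A t%:C -> p.[t] <= e) ->
  forall x, qf (op_poly p A) x <= e * nsq x.
Proof.
move=> sA hp x; have := @op_poly_ge0 (e%:P - p) A sA _ x.
rewrite op_polyD op_polyN op_polyC !qfE subr_ge0; apply.
by move=> t /hp; rewrite !hornerE subr_ge0.
Qed.

Lemma op_poly_ge p A (e : R) : selfadjoint A ->
  (forall t : R, spectrum A t%:C -> e <= p.[t]) ->
  forall x, e * nsq x <= qf (op_poly p A) x.
Proof.
move=> sA hp x; have := @op_poly_ge0 (p - e%:P) A sA _ x.
rewrite op_polyD -polyCN op_polyC !qfE mulNr subr_ge0; apply.
by move=> t /hp; rewrite !hornerE subr_ge0.
Qed.

Lemma op_poly_norm p A (e : R) : selfadjoint A -> 0 < e ->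
  (forall t : R, spectrum A t%:C -> `|p.[t]| <= e) ->
  forall x, nrm (op_poly p A x) <= e * nrm x.
Proof.
move=> sA e0 hp x; rewrite le_nrm_nsq ?(ltW e0) //.
apply: nsq_qf_le => //; first exact: sa_op_poly.
move=> {}x; rewrite -mulNr.
rewrite op_poly_le ?op_poly_ge // => t /hp; by rewrite ler_norml => /andP[].
Qed.

End Spectrum.

(** * Weierstrass approximation *)

Section Weierstrass.
Context {R : realType}.
Implicit Types (F G : nat -> R) (f : R -> R).

(* Bernstein polynomials, without binomial coefficients: at [x], the expected
   value of [F] at the number of heads after [n] tosses of bias [x]. *)
Fixpoint bernstein n F : {poly R} :=
  if n is n'.+1 then
    (1 - 'X) * bernstein n' F + 'X * bernstein n' (fun k => F k.+1)
  else (F 0%N)%:P.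

Lemma bernsteinS n F x : (bernstein n.+1 F).[x] =
  (1 - x) * (bernstein n F).[x] + x * (bernstein n (fun k => F k.+1)).[x].
Proof. by rewrite /= !hornerE. Qed.

Lemma le_bernstein n F G x : 0 <= x <= 1 ->
  (forall k, (k <= n)%N -> F k <= G k) ->
  (bernstein n F).[x] <= (bernstein n G).[x].
Proof.
move=> /andP[x0 x1]; elim: n F G => [|n IHn] F G FG.
  by rewrite !hornerE FG.
rewrite !bernsteinS; apply: lerD; apply: ler_wpM2l; rewrite ?subr_ge0 //.
  by apply: IHn => k kn; apply: FG; exact: leqW.
by apply: IHn => k kn; apply: FG.
Qed.

Lemma bernsteinN n F x :
  (bernstein n (fun k => - F k)).[x] = - (bernstein n F).[x].
Proof.
elim: n F => [|n IHn] F; first by rewrite !hornerE.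
by rewrite !bernsteinS !IHn !mulrN opprD.
Qed.

Lemma bernsteinB n F c x :
  (bernstein n (fun k => F k - c)).[x] = (bernstein n F).[x] - c.
Proof.
elim: n F => [|n IHn] F; first by rewrite !hornerE.
by rewrite !bernsteinS (IHn (fun k => F k.+1)) IHn; ring.
Qed.

(** Second moment of a binomial variable about [c]: variance plus squared bias. Keeping [c] general
    lets the induction absorb the shift of [k] by replacing [c] with [c - 1]. *)
Lemma bernstein_quad n c u v x :
  (bernstein n (fun k => u + v * (k%:R - c) ^+ 2)).[x] =
  u + v * (n%:R * x * (1 - x) + (n%:R * x - c) ^+ 2).
Proof.
elim: n c => [|n IHn] c; first by rewrite /= !hornerE; ring.
rewrite bernsteinS IHn.
have -> : (fun k : nat => u + v * (k.+1%:R - c) ^+ 2) =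
    (fun k : nat => u + v * (k%:R - (c - 1)) ^+ 2).
  by apply/funext => k; rewrite -natr1; congr (_ + _ * _ ^+ 2); ring.
by rewrite IHn -natr1; ring.
Qed.

(** Points closer than [d] are handled by uniform continuity, the others by the oscillation [L] of
    [f] with [C = L / d ^+ 2]. The majorant is quadratic so that [bernstein_quad] can average it. *)
Lemma heine_quad f a b e : {within `[a, b], continuous f} -> 0 < e ->
  exists2 C, 0 <= C & forall x y, a <= x <= b -> a <= y <= b ->
    `|f x - f y| <= e + C * (x - y) ^+ 2.
Proof.
move=> cf e0; have [ab|ba] := leP a b; last first.
  exists 0 => // x y /andP[ax xb].
  by have := lt_le_trans ba (le_trans ax xb); rewrite ltxx.
have [c1 _ h1] := EVT_max ab cf; have [c2 _ h2] := EVT_min ab cf.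
pose L := f c1 - f c2.
have fL x y : a <= x <= b -> a <= y <= b -> `|f x - f y| <= L.
  move=> hx hy; have := h1 x; have := h2 x; have := h1 y; have := h2 y.
  rewrite !in_itv /= hx hy /L => /(_ isT) ? /(_ isT) ? /(_ isT) ? /(_ isT) ?.
  by rewrite ler_norml; apply/andP; split; lra.
have cpt : compact `[a, b] := @segment_compact R a b.
have e2 : 0 < e / 2 by lra.
pose P (d x : R) := a <= x <= b -> forall y, a <= y <= b -> `|x - y| < d ->
  `|f x - f y| <= e.
have : \forall d \near 0^'+, forall x, `[a, b]%classic x -> P d x.
  apply: ((compact_near_coveringP _).1 cpt R (0^'+) P _) => x0 x0ab.
  have /subspace_continuousP/(_ x0 x0ab) := cf.
  move=> /cvgrPdist_lt /(_ _ e2); rewrite near_withinE near_simpl.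
  rewrite -nbhs_nearE => /nbhs_ballP[r /= r0 hr].
  have r2 : 0 < r / 2 by lra.
  exists (ball x0 (r / 2), [set d | d < r / 2]).
    by split; [exact: nbhsx_ballx | exact: nbhs_right_lt].
  move=> [x d] [/= hx hd] xab y yab xy.
  move: hx; rewrite -ball_normE /= => hx.
  have h z : a <= z <= b -> `|x0 - z| < r -> `|f x0 - f z| < e / 2.
    by move=> zab zr; apply: hr; rewrite /= ?in_itv //= -ball_normE.
  have hx' : `|f x0 - f x| < e / 2 by apply: h => //; lra.
  have hy' : `|f x0 - f y| < e / 2.
    apply: h => //; have -> : x0 - y = (x0 - x) + (x - y) by ring.
    by apply: le_lt_trans (ler_normD _ _) _; lra.
  have -> : f x - f y = - (f x0 - f x) + (f x0 - f y) by ring.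
  by apply: le_trans (ler_normD _ _) _; rewrite normrN; lra.
move=> hP; have [d [d0 hd]] :
    exists d, 0 < d /\ forall x, `[a, b]%classic x -> P d x.
  near (0 : R)^'+ => d; exists d; split; first by [].
  by near: d.
have L0 : 0 <= L by have := fL a a; rewrite !lexx ab subrr normr0; apply.
exists (L / d ^+ 2); first by rewrite divr_ge0 // sqr_ge0.
move=> x y xab yab; have [xy|xy] := ltP `|x - y| d.
  have := hd x; rewrite /= in_itv /= => /(_ xab xab y yab xy) /le_trans; apply.
  by rewrite lerDl mulr_ge0 ?sqr_ge0 // divr_ge0 // sqr_ge0.
apply: le_trans (fL _ _ xab yab) _; apply: ler_wpDl; first exact: ltW.
rewrite mulrAC ler_pdivlMr ?exprn_gt0 //; apply: ler_wpM2l => //.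
by rewrite -(real_normK (num_real (x - y))) ler_pXn2r // ?nnegrE // ltW.
Unshelve. all: by end_near. Qed.

Lemma weierstrass f a b : a < b -> {within `[a, b], continuous f} ->
  forall e, 0 < e -> exists p : {poly R}, forall x, a <= x <= b ->
    `|p.[x] - f x| <= e.
Proof.
move=> ab cf e e0; have e2 : 0 < e / 2 by lra.
have [C C0 hC] := heine_quad cf e2.
pose l := b - a; have l0 : 0 < l by rewrite /l; lra.
(* Averaging the majorant leaves the variance term, at most [C * l ^+ 2 / n%:R]; this [n] brings it
   below [e / 2]. *)
pose n := (Num.truncn (C * l ^+ 2 / (e / 2))).+1.
have n0 : 0 < n%:R :> R by rewrite ltr0n.
have hn : C * l ^+ 2 / n%:R <= e / 2.
  by rewrite ler_pdivrMr // [leRHS]mulrC -ler_pdivrMr // ltW // /n truncnS_gt.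
pose y k : R := a + l * (k%:R / n%:R).
pose q := bernstein n (fun k => f (y k)).
exists (q \Po ((l^-1)%:P * ('X - a%:P))) => x xab.
rewrite horner_comp.
have -> : ((l^-1)%:P * ('X - a%:P)).[x] = l^-1 * (x - a) by rewrite !hornerE.
set t := l^-1 * (x - a).
have xt : x = a + l * t by rewrite /t mulVKf ?gt_eqF // addrC subrK.
have t01 : 0 <= t <= 1.
  have /andP[ax xb] := xab; apply/andP; split.
    by rewrite /t mulr_ge0 ?subr_ge0 // invr_ge0 ltW.
  by rewrite /t mulrC ler_pdivrMr // mul1r /l lerD2r.
have yab k : (k <= n)%N -> a <= y k <= b.
  move=> kn; have k0 : 0 <= k%:R / n%:R :> R by rewrite divr_ge0.
  have k1 : k%:R / n%:R <= 1 :> R by rewrite ler_pdivrMr // mul1r ler_nat.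
  apply/andP; split; first by rewrite /y lerDl mulr_ge0 // ltW.
  by have := ler_wpM2l (ltW l0) k1; rewrite mulr1 /y {2}/l; lra.
pose v := C * l ^+ 2 / n%:R ^+ 2.
have hy k : (k <= n)%N ->
    `|f (y k) - f x| <= e / 2 + v * (k%:R - n%:R * t) ^+ 2.
  move=> kn; apply: le_trans (hC _ _ (yab k kn) xab) _.
  rewrite lerD2l le_eqVlt; apply/orP; left; apply/eqP.
  by rewrite xt /y /v; field; rewrite gt_eqF.
have tot : e / 2 + v * (n%:R * t * (1 - t) + (n%:R * t - n%:R * t) ^+ 2) <= e.
  rewrite subrr expr0n addr0.
  have -> : v * (n%:R * t * (1 - t)) = C * l ^+ 2 / n%:R * (t * (1 - t)).
    by rewrite /v; field; rewrite gt_eqF.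
  have c0 : 0 <= C * l ^+ 2 / n%:R by rewrite divr_ge0 ?mulr_ge0 ?sqr_ge0 // ltW.
  move/andP: t01 => [t0 t1].
  have h : t * (1 - t) <= 1 by nra.
  have := ler_wpM2l c0 h; rewrite mulr1; lra.
rewrite /q -bernsteinB ler_norml; apply/andP; split.
  rewrite -[leRHS]opprK lerN2 -bernsteinN; apply: le_trans tot.
  rewrite -bernstein_quad; apply: le_bernstein => // k /hy.
  by apply: le_trans; rewrite -normrN ler_norm.
apply: le_trans tot; rewrite -bernstein_quad; apply: le_bernstein => // k /hy.
by apply: le_trans; rewrite ler_norm.
Qed.

End Weierstrass.

(** * Functional calculus *)

Section FunctionalCalculus.
Context {R : realType} {H : hilbertType R}.
Implicit Types (A B C : 'B(H)) (p q : {poly R}) (f g : R -> R).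

Lemma le_of_le_mul_eps (a b c : R) :
  0 <= c -> (forall e, 0 < e -> a <= b + e * c) -> a <= b.
Proof.
move=> c0 h; apply/ler_addgt0Pr => e e0.
have c1 : 0 < c + 1 by lra.
apply: le_trans (h (e / (c + 1)) (divr_gt0 e0 c1)) _.
by rewrite lerD2l mulrAC ler_pdivrMr // ler_pM2l // lerDl.
Qed.

(** Expand the squared norms of [y] plus or minus [e x] for the real part, and of [y] plus or minus
    [i e x] for the imaginary part. *)
Lemma inner_le (x y : H) (e : R) : 0 < e -> nrm y <= e * nrm x ->
  `|complex.Re (inner y x)| <= e * nsq x /\
  `|complex.Im (inner y x)| <= e * nsq x.
Proof.
move=> e0; rewrite le_nrm_nsq ?(ltW e0) // => yx.
have h1 := nsq_ge0 (y + e%:C *: x); have h2 := nsq_ge0 (y + (- e)%:C *: x).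
have h3 := nsq_ge0 (y + e *i *: x); have h4 := nsq_ge0 (y + (- e) *i *: x).
move: h1 h2 h3 h4; rewrite !nsqD !innerZr.
have nsqi (r : R) : nsq (r *i *: x) = r ^+ 2 * nsq x.
  by rewrite /nsq innerZl innerZr nsqE /=; ring.
rewrite !nsqi !nsqZ; case: (inner y x) => u v /= h1 h2 h3 h4.
by split; rewrite ler_norml; apply/andP; split; nra.
Qed.

Lemma sa_eq A B : selfadjoint A -> selfadjoint B ->
  (forall x, qf A x = qf B x) -> A = B.
Proof.
move=> sA sB AB; apply/eqP; rewrite -subr_eq0; apply/eqP; apply: bop_ext => x.
apply: (@nrm_small _ _ _ (nrm x)) => e e0.
rewrite le_nrm_nsq ?(ltW e0) //; apply: nsq_qf_le => //; first exact: saB.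
move=> y; rewrite !qfE AB subrr oppr_le0.
by rewrite mulr_ge0 ?nsq_ge0 // ltW.
Qed.

Lemma is_cfcP f A B : is_cfc f A B <-> forall e : R, 0 < e -> exists p,
  (forall t : R, spectrum A t%:C -> `|p.[t] - f t| <= e) /\
  (forall x : H, nrm (op_poly p A x - B x) <= e * nrm x).
Proof.
split=> h e /h[p [hp Bp]]; exists p; split=> // x; have := Bp x;
  by rewrite !nrmE -rmorphM lecR.
Qed.

Lemma is_cfc_sa f A B : selfadjoint A -> is_cfc f A B -> selfadjoint B.
Proof.
move=> sA /is_cfcP hB; apply: inner_real_sa => x.
apply/eqP; rewrite -normr_eq0 eq_le normr_ge0 andbT.
apply: (@le_of_le_mul_eps _ _ (nsq x)) => [|e e0]; first exact: nsq_ge0.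
have [p [_ Bp]] := hB _ e0.
have [_] := inner_le e0 (Bp x); rewrite innerDl innerNl.
rewrite (sa_inner _ (sa_op_poly p sA)) add0r.
by case: (inner _ _) => u v /=; rewrite sub0r normrN.
Qed.

Lemma qf_approx A B (e : R) : 0 < e ->
  (forall x, nrm (A x - B x) <= e * nrm x) ->
  forall x, `|qf A x - qf B x| <= e * nsq x.
Proof.
move=> e0 h x; have [+ _] := inner_le e0 (h x).
by rewrite innerDl innerNl ReD -innerNl -[X in _ + X]/(qf (- B) x) qfN.
Qed.

Lemma is_cfc_le f g A B C : selfadjoint A -> is_cfc f A B -> is_cfc g A C ->
  (forall t : R, spectrum A t%:C -> f t <= g t) -> forall x, qf B x <= qf C x.
Proof.
move=> sA /is_cfcP hB /is_cfcP hC fg x.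
(* The 4 counts [2 e] for [p - q] on the spectrum and [e] for each of the two operator
   approximations. *)
apply: (@le_of_le_mul_eps _ _ (4 * nsq x)) => [|e e0].
  by rewrite mulr_ge0 ?nsq_ge0.
have [p [pf /(qf_approx e0)/(_ x) Bp]] := hB _ e0.
have [q [qg /(qf_approx e0)/(_ x) Cq]] := hC _ e0.
have := @op_poly_le _ _ (p - q) A (2 * e) sA _ x.
rewrite op_polyD op_polyN !qfE => h.
have {}h : qf (op_poly p A) x - qf (op_poly q A) x <= 2 * e * nsq x.
  apply: h => t tA; have := pf t tA; have := qg t tA; have := fg t tA.
  by rewrite !hornerE !ler_norml => ? /andP[? ?] /andP[? ?]; lra.
by move: Bp Cq; rewrite !ler_norml => /andP[? ?] /andP[? ?]; lra.
Qed.

Lemma is_cfc_eq f g A B C : selfadjoint A -> is_cfc f A B -> is_cfc g A C ->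
  (forall t : R, spectrum A t%:C -> f t = g t) -> B = C.
Proof.
move=> sA hB hC fg; apply: sa_eq; [exact: is_cfc_sa hB|exact: is_cfc_sa hC|].
move=> x; apply/eqP; rewrite eq_le.
by rewrite (is_cfc_le sA hB hC) ?(is_cfc_le sA hC hB) // => t /fg ->.
Qed.

Lemma cfcE f A B : selfadjoint A -> is_cfc f A B -> cfc f A = B.
Proof.
move=> sA hB; have : is_cfc f A (cfc f A).
  by apply: (@xgetPex _ 0 [set B | is_cfc f A B]); exists B.
by move=> h; apply: is_cfc_eq h hB _.
Qed.

Lemma is_cfc_poly p A : is_cfc (fun t => p.[t]) A (op_poly p A).
Proof.
apply/is_cfcP => e e0; exists p; split=> [t _|x].
  by rewrite subrr normr0 ltW.
by rewrite subrr /nrm normr0 mulr_ge0 ?nrm_ge0 // ltW.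
Qed.

(** Existence: take Weierstrass polynomials with error [d n]. By [op_poly_norm] their values at [A]
    differ by at most [d m + d n] in norm, the form required by [bop_limit]. *)
Lemma is_cfc_cfc f A a b : selfadjoint A -> a < b -> spectrum_in A `[a, b] ->
  {within `[a, b], continuous f} -> is_cfc f A (cfc f A).
Proof.
move=> sA ab Aab cf.
have Aab' (t : R) : spectrum A t%:C -> a <= t <= b.
  by move=> /Aab[s]; rewrite /= in_itv /= => sab [<-].
suff [B hB] : exists B, is_cfc f A B by rewrite (cfcE sA hB).
pose d n : R := n.+1%:R^-1.
have d0 n : 0 < d n by rewrite invr_gt0 ltr0n.
have dS e : 0 < e -> exists N, forall n, (N <= n)%N -> d n <= e.
  move=> e0; exists (Num.truncn e^-1) => n hn; rewrite /d invf_ple ?posrE //.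
  by apply: ltW; apply: lt_le_trans (truncnS_gt _) _; rewrite ler_nat ltnS.
pose p n := sval (cid (weierstrass ab cf (d0 n))).
have hp n t : a <= t <= b -> `|(p n).[t] - f t| <= d n.
  by move: t; rewrite /p; case: cid.
have [m n x|B hB] := bop_limit (u := fun n => op_poly (p n) A) dS.
  have -> : op_poly (p m) A x - op_poly (p n) A x = op_poly (p m - p n) A x.
    by rewrite op_polyD op_polyN.
  apply: op_poly_norm => //; first by rewrite addr_gt0.
  move=> t /Aab' tab; rewrite hornerD hornerN.
  have -> : (p m).[t] - (p n).[t] = ((p m).[t] - f t) - ((p n).[t] - f t) by ring.
  apply: le_trans (ler_normD _ _) _; rewrite normrN; apply: lerD; exact: hp.
exists B; apply/is_cfcP => e /dS[N hN]; exists (p N); split=> [t /Aab' tab|x].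
  by apply: le_trans (hp _ _ tab) _; exact: hN.
apply: le_trans (hB N x) _; apply: ler_wpM2r; [exact: nrm_ge0 | exact: hN].
Qed.

Lemma is_cfc_bound f A B c : selfadjoint A -> is_cfc f A B ->
  (forall t : R, spectrum A t%:C -> `|f t| <= c) -> 0 < c ->
  forall x, nrm (B x) <= c * nrm x.
Proof.
move=> sA hB fc c0 x; rewrite le_nrm_nsq ?(ltW c0) //.
apply: nsq_qf_le => //; first exact: is_cfc_sa hB.
move=> {}x; have hC := is_cfc_poly (- c%:P) A; have hD := is_cfc_poly c%:P A.
apply/andP; split.
  have := is_cfc_le sA hC hB _ x; rewrite op_polyN op_polyC !qfE; apply.
  by move=> t /fc; rewrite !hornerE ler_norml => /andP[].
have := is_cfc_le sA hB hD _ x; rewrite op_polyC !qfE; apply.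
by move=> t /fc; rewrite !hornerE ler_norml => /andP[].
Qed.

Lemma is_cfcM f g A B C c : selfadjoint A -> is_cfc f A B -> is_cfc g A C ->
  (forall t : R, spectrum A t%:C -> `|f t| <= c) ->
  (forall t : R, spectrum A t%:C -> `|g t| <= c) ->
  is_cfc (fun t => f t * g t) A (B * C).
Proof.
move=> sA hB hC fc' gc'; apply/is_cfcP => e e0.
pose c1 := `|c| + 1; have c10 : 0 < c1 by rewrite /c1 ltr_wpDl.
have fc t : spectrum A t%:C -> `|f t| <= c1.
  by move=> /fc' /le_trans; apply; rewrite /c1; have := ler_norm c; lra.
have gc t : spectrum A t%:C -> `|g t| <= c1.
  by move=> /gc' /le_trans; apply; rewrite /c1; have := ler_norm c; lra.
have c2 : 0 < 2 * c1 + 1 by lra.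
(* Write [p q - f g = p (q - g) + g (p - f)]. The cap [d <= 1] bounds [p] by [c1 + 1], and the total
   error is [(c1 + 1) d + c1 d]. *)
pose d := Num.min 1 (e / (2 * c1 + 1)).
have d0 : 0 < d by rewrite lt_min ltr01 divr_gt0.
have d1 : d <= 1 by rewrite ge_min lexx.
have de : (c1 + 1) * d + c1 * d <= e.
  have : d <= e / (2 * c1 + 1) by rewrite ge_min lexx orbT.
  by rewrite ler_pdivlMr //; lra.
have /is_cfcP/(_ _ d0)[p [pf pB]] := hB.
have /is_cfcP/(_ _ d0)[q [qg qC]] := hC.
have pc t : spectrum A t%:C -> `|p.[t]| <= c1 + 1.
  move=> tA; rewrite -[p.[t]](subrK (f t)) addrC.
  apply: le_trans (ler_normD _ _) _; apply: lerD; first exact: fc.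
  by apply: le_trans (pf t tA) d1.
exists (p * q); split=> [t tA|x].
  rewrite hornerM.
  have -> : p.[t] * q.[t] - f t * g t =
    p.[t] * (q.[t] - g t) + g t * (p.[t] - f t) by ring.
  apply: le_trans de; apply: le_trans (ler_normD _ _) _.
  rewrite !normrM; apply: lerD; apply: ler_pM => //;
    [exact: pc|exact: qg|exact: gc|exact: pf].
rewrite op_polyM !bopME.
have -> : op_poly p A (op_poly q A x) - B (C x) =
    op_poly p A (op_poly q A x - C x) + (op_poly p A (C x) - B (C x)).
  by rewrite bopvD bopvN addrA subrK.
apply: le_trans (_ : ((c1 + 1) * d + c1 * d) * nrm x <= _); last first.
  by apply: ler_wpM2r => //; exact: nrm_ge0.
apply: le_trans (nrmD _ _) _; rewrite mulrDl; apply: lerD.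
  have c3 : 0 < c1 + 1 by lra.
  apply: le_trans (op_poly_norm sA c3 pc _) _.
  by rewrite -mulrA; apply: ler_wpM2l; [exact: ltW | exact: qC].
apply: le_trans (pB _) _; rewrite [leRHS]mulrAC [leRHS]mulrC.
by apply: ler_wpM2l; [exact: ltW | exact: (is_cfc_bound sA hC gc)].
Qed.

(** Induction on [q] by Horner's scheme. A bound on [q] along [f] is carried along because [is_cfcM]
    asks for bounded factors. *)
Lemma is_cfc_horner f A B c q : selfadjoint A -> is_cfc f A B ->
  (forall t : R, spectrum A t%:C -> `|f t| <= c) ->
  is_cfc (fun t => q.[f t]) A (op_poly q B).
Proof.
move=> sA hB fc.
suff [] : (exists k : R, forall t : R, spectrum A t%:C -> `|q.[f t]| <= k) /\
  is_cfc (fun t => q.[f t]) A (op_poly q B) by [].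
elim/poly_ind: q => [|q r [[k hk] IHq]].
  split; first by exists 0 => t _; rewrite horner0 normr0.
  have := is_cfc_poly 0 A; rewrite -[0]/(0%:P) !op_polyC.
  suff -> : (fun t => 0%:P.[t]) = (fun t => 0%:P.[f t]) :> (R -> R) by [].
  by apply/funext => t; rewrite !hornerC.
pose c1 := Num.max k c.
have kc t : spectrum A t%:C -> `|q.[f t]| <= c1.
  by move=> /hk h; rewrite le_max h.
have fc1 t : spectrum A t%:C -> `|f t| <= c1.
  by move=> /fc h; rewrite le_max h orbT.
split.
  exists (k * c + `|r|) => t tA; rewrite !hornerE.
  apply: le_trans (ler_normD _ _) _; rewrite lerD2r normrM.
  by apply: ler_pM => //; [exact: hk | exact: fc].
have hM := is_cfcM sA IHq hB kc fc1.
apply/is_cfcP => e e0; have /is_cfcP/(_ _ e0)[p [hp Bp]] := hM.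
exists (p + r%:P); split=> [t tA|x].
  by rewrite !hornerE opprD addrACA subrr addr0; exact: hp.
rewrite !op_polyD op_polyM op_polyX !op_polyC !bopDE.
by rewrite opprD addrACA !bopZE !bop1E subrr addr0; exact: Bp.
Qed.

Lemma is_cfc_spectrum_in f A B (c d : R) : selfadjoint A -> is_cfc f A B ->
  (forall t : R, spectrum A t%:C -> c <= f t <= d) -> spectrum_in B `[c, d].
Proof.
move=> sA hB fcd; apply: qf_spectrum_in; first exact: is_cfc_sa hB.
move=> x; apply/andP; split.
  have := is_cfc_le sA (is_cfc_poly c%:P A) hB _ x; rewrite op_polyC !qfE.
  by apply=> t /fcd; rewrite !hornerE => /andP[].
have := is_cfc_le sA hB (is_cfc_poly d%:P A) _ x; rewrite op_polyC !qfE.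
by apply=> t /fcd; rewrite !hornerE => /andP[].
Qed.

(** The polynomial [r] defining [cfc g B] is controlled only on the spectrum of [B], while [f t] is
    known only to lie in [[c, d]]. A second polynomial [q], close to [g] on all of [[c, d]], links
    the two; the errors are [e / 4], [e / 2] and [e / 4]. *)
Lemma is_cfc_comp f g A B (c d : R) : selfadjoint A -> is_cfc f A B -> c < d ->
  (forall t : R, spectrum A t%:C -> c <= f t <= d) ->
  {within `[c, d], continuous g} -> is_cfc (g \o f) A (cfc g B).
Proof.
move=> sA hB cd fcd cg; have sB := is_cfc_sa sA hB.
have Bcd := is_cfc_spectrum_in sA hB fcd.
have hg := is_cfc_cfc sB cd Bcd cg.
apply/is_cfcP => e e0; have e2 : 0 < e / 2 by lra.
have e4 : 0 < e / 4 by lra.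
have [q hq] := weierstrass cd cg e4.
have fk t : spectrum A t%:C -> `|f t| <= `|c| + `|d|.
  move=> /fcd /andP[h1 h2]; rewrite ler_norml; have := ler_norm d.
  have := ler_norm (- c); rewrite normrN; have := normr_ge0 c.
  by have := normr_ge0 d; move=> ? ? ? ?; apply/andP; split; lra.
have /is_cfcP/(_ _ e4)[p [hp pB]] := is_cfc_horner q sA hB fk.
have /is_cfcP/(_ _ e4)[r [hr rB]] := hg.
exists p; split=> [t tA|x].
  have -> : p.[t] - (g \o f) t = (p.[t] - q.[f t]) + (q.[f t] - g (f t)).
    by rewrite addrA subrK.
  apply: le_trans (ler_normD _ _) _.
  by have := hp t tA; have := hq _ (fcd t tA); lra.
have qr x' : nrm (op_poly (q - r) B x') <= e / 2 * nrm x'.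
  apply: op_poly_norm => // t tB.
  have tcd : c <= t <= d by have [s] := Bcd _ tB; rewrite /= in_itv /= => ? [<-].
  rewrite hornerD hornerN.
  have -> : q.[t] - r.[t] = (q.[t] - g t) - (r.[t] - g t) by ring.
  apply: le_trans (ler_normD _ _) _; rewrite normrN.
  by have := hq t tcd; have := hr t tB; lra.
have -> : op_poly p A x - cfc g B x = (op_poly p A x - op_poly q B x) +
    (op_poly (q - r) B x + (op_poly r B x - cfc g B x)).
  by rewrite op_polyD op_polyN bopDE bopNE !subrKA.
apply: le_trans (nrmD _ _) _; apply: le_trans (lerD (pB x) (nrmD _ _)) _.
by have := qr x; have := rB x; lra.
Qed.

End FunctionalCalculus.

(** * Real functions *)

Section RealAnalysis.
Context {R : realType}.
Implicit Types (f g : R -> R) (a b t : R).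

(** Within distance [min (t - a) (b - t)] of an interior point the restriction to [[a, b]] is void,
    so the limit is the two-sided one. *)
Lemma deriv_on_is_derive f a b t : a < t < b -> derivable_on `[a, b] f t ->
  is_derive t 1 f (deriv_on `[a, b] f t).
Proof.
move=> /andP[at_ tb] df.
have {}df : diff_quot f t s @[s --> within `[a, b] t^'] -->
    deriv_on `[a, b] f t by [].
set L := deriv_on _ _ _ in df *.
have cv : h^-1 *: ((f \o shift t) (h *: 1) - f t) @[h --> 0^'] --> L.
  apply/cvgrPdist_lt => e e0.
  move/cvgrPdist_lt/(_ _ e0) : df.
  rewrite near_withinE => /nbhs_ballP[r /= r0 hr].
  pose d := Num.min r (Num.min (t - a) (b - t)).
  have d0 : 0 < d by rewrite !lt_min r0 !subr_gt0 at_ tb.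
  apply/nbhs_ballP; exists d => //= h; rewrite -ball_normE /= sub0r normrN => hd h0.
  move: hd; rewrite !lt_min => /and3P[hr0 /ltr_normlP[h1 h2] /ltr_normlP[h3 h4]].
  have := hr (h + t); rewrite -ball_normE /= in_itv /=.
  have -> : t - (h + t) = - h by ring.
  rewrite normrN => /(_ hr0).
  have ht : h + t != t by rewrite -subr_eq0 addrK.
  move=> /(_ ht) hh.
  have -> : h *: (1 : R) + t = h + t by rewrite /GRing.scale /= mulr1.
  rewrite /GRing.scale /= mulrC.
  have := hh; rewrite /diff_quot addrK; apply.
  by apply/andP; split; lra.
apply: DeriveDef; first by apply/cvg_ex; exists L.
exact: cvg_lim cv.
Qed.

Lemma within_continuous_comp f g (A B : set R) :
  {within A, continuous f} -> (forall x, A x -> B (f x)) ->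
  {within B, continuous g} -> {within A, continuous (g \o f)}.
Proof.
move=> /subspace_continuousP fA AB /subspace_continuousP gB.
apply/subspace_continuousP => x Ax.
apply: cvg_comp (gB (f x) (AB x Ax)) => P; rewrite /within /= => hP.
have : nbhs x (fun y => A y -> B (f y) -> P (f y)) := fA x Ax _ hP.
apply: filterS => y h Ay.
by apply: h => //; exact: AB.
Qed.

(** If [f] exceeded the quadratic at [t], the mean value theorem on both sides of [t] would give a
    positive slope of the difference before [t] and a negative one after it; a third application, to
    the slopes, contradicts [alpha <= f2]. Below, [q] omits [c0] and [h1] omits [c1], so [h] has
    derivative [h1 - c1]. *)
Lemma le_quadratic f f1 f2 a b (alpha c1 c0 : R) :
  {within `[a, b], continuous f} ->
  (forall t, a < t < b -> is_derive t 1 f (f1 t)) ->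
  (forall t, a < t < b -> is_derive t 1 f1 (f2 t)) ->
  (forall t, a < t < b -> alpha <= f2 t) ->
  f a = alpha / 2 * a ^+ 2 + c1 * a + c0 ->
  f b = alpha / 2 * b ^+ 2 + c1 * b + c0 ->
  forall t, a <= t <= b -> f t <= alpha / 2 * t ^+ 2 + c1 * t + c0.
Proof.
move=> cf df df1 f2a fa fb t /andP[ta tb].
rewrite leNgt; apply/negP => ft.
have {}ta : a < t.
  by rewrite lt_neqAle ta andbT; apply/eqP => e; move: ft; rewrite -e fa ltxx.
have {}tb : t < b.
  by rewrite lt_neqAle tb andbT; apply/eqP => e; move: ft; rewrite e fb ltxx.
pose q : R -> R := (alpha / 2) \*: (@id R ^+ 2) + c1 \*: @id R.
pose h : R -> R := f - q.
pose h1 : R -> R := f1 - alpha \*: @id R.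
have qE s : q s = alpha / 2 * s ^+ 2 + c1 * s.
  by rewrite /q /= [(_ + _) s]/(_ s + _ s) /= exprfctE.
have hE s : h s = f s - q s by [].
have h1E s : h1 s = f1 s - alpha * s by [].
have dq (s : R) : is_derive s 1 q (alpha * s + c1).
  by apply: is_derive_eq; rewrite /GRing.scale /= expr1; field.
have dh (s : R) : a < s < b -> is_derive s 1 h (h1 s - c1).
  move=> /df ds; apply: is_derive_eq.
  by rewrite h1E opprD addrA.
have dh1 (s : R) : a < s < b -> is_derive s 1 h1 (f2 s - alpha).
  move=> /df1 ds; apply: is_derive_eq.
  by rewrite /GRing.scale /=; ring.
have ch : {within `[a, b], continuous h}.
  rewrite /h => s; apply: continuousD _; first exact: cf.
  apply/continuousN/continuous_subspaceT => x.
  by apply/differentiable_continuous/derivable1_diffP; exact: @ex_derive (dq x).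
have ch1 (s : R) : a < s < b -> {for s, continuous h1}.
  move=> /dh1 ds; apply/differentiable_continuous/derivable1_diffP.
  exact: ex_derive.
have sub u v : a <= u -> v <= b -> `[u, v]%classic `<=` `[a, b]%classic.
  by move=> au vb x; rewrite /= !in_itv /= => /andP[? ?]; apply/andP; split; lra.
have [c cat hc] : exists2 c, c \in `]a, t[ & h t - h a = (h1 c - c1) * (t - a).
  apply: MVT => // [x|]; first by rewrite in_itv /= => /andP[? ?]; apply: dh; lra.
  by apply: continuous_subspaceW ch; apply: sub; lra.
have [d dtb hd] : exists2 d, d \in `]t, b[ & h b - h t = (h1 d - c1) * (b - t).
  apply: MVT => // [x|]; first by rewrite in_itv /= => /andP[? ?]; apply: dh; lra.
  by apply: continuous_subspaceW ch; apply: sub; lra.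
move: cat dtb; rewrite !in_itv /= => /andP[ac ct] /andP[td db].
have cd : c < d by lra.
have [e] : exists2 e, e \in `]c, d[ & h1 d - h1 c = (f2 e - alpha) * (d - c).
  apply: MVT => // [x|]; first by rewrite in_itv /= => /andP[? ?]; apply: dh1; lra.
  apply: continuous_in_subspaceT => x; rewrite inE /= in_itv /= => /andP[? ?].
  by apply: ch1; lra.
rewrite in_itv /= => /andP[ce ed] he.
have fe : alpha <= f2 e by apply: f2a; lra.
move: hc hd; rewrite !hE !qE fa fb => hc hd.
have {}hc : 0 < (h1 c - c1) * (t - a) by lra.
have {}hd : (h1 d - c1) * (b - t) < 0 by lra.
move: hc; rewrite pmulr_lgt0 ?subr_gt0 // => hc.
move: hd; rewrite pmulr_llt0 ?subr_gt0 // => hd.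
have : 0 <= (f2 e - alpha) * (d - c) by rewrite mulr_ge0 // subr_ge0 // ltW.
by rewrite -he; lra.
Qed.

Lemma ge_quadratic f f1 f2 a b (beta c1 c0 : R) :
  {within `[a, b], continuous f} ->
  (forall t, a < t < b -> is_derive t 1 f (f1 t)) ->
  (forall t, a < t < b -> is_derive t 1 f1 (f2 t)) ->
  (forall t, a < t < b -> f2 t <= beta) ->
  f a = beta / 2 * a ^+ 2 + c1 * a + c0 ->
  f b = beta / 2 * b ^+ 2 + c1 * b + c0 ->
  forall t, a <= t <= b -> beta / 2 * t ^+ 2 + c1 * t + c0 <= f t.
Proof.
move=> cf df df1 f2b fa fb t tab.
have := @le_quadratic (- f) (- f1) (- f2) a b (- beta) (- c1) (- c0).
move=> /(_ _ _ _ _ _ _ t tab); rewrite /= => h.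
suff : - f t <= - beta / 2 * t ^+ 2 + - c1 * t + - c0 by lra.
apply: h.
- by move=> s; apply/continuousN/cf.
- by move=> s /df ds; exact: is_deriveN.
- by move=> s /df1 ds; exact: is_deriveN.
- by move=> s /f2b; rewrite lerN2.
- transitivity (- f a) => //; rewrite fa !mulNr !opprD //.
- transitivity (- f b) => //; rewrite fb !mulNr !opprD //.
Qed.

Lemma quadratic_interpolation f a b (alpha : R) : a < b -> exists c1 c0,
  f a = alpha / 2 * a ^+ 2 + c1 * a + c0 /\
  f b = alpha / 2 * b ^+ 2 + c1 * b + c0.
Proof.
(* The chord slope of [f] minus that of [alpha / 2 * t ^+ 2]. *)
move=> ab; pose c1 := (f b - f a) / (b - a) - alpha / 2 * (a + b).
exists c1, (f a - alpha / 2 * a ^+ 2 - c1 * a); split; first by ring.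
by rewrite /c1; field; rewrite subr_eq0 gt_eqF.
Qed.

(** The endpoints come as an unordered alternative, so that increasing and decreasing functions are
    treated together: only symmetric expressions in [f m] and [f M] occur later. *)
Lemma strictly_monotone_inverse f m M : m < M ->
  {within `[m, M], continuous f} -> strictly_monotone `[m, M] f ->
  exists a b, [/\ a < b, (a = f m /\ b = f M) \/ (a = f M /\ b = f m),
    f @` `[m, M] = `[a, b]%classic, {within `[a, b], continuous (finv_on m M f)} &
    forall t, m <= t <= M -> finv_on m M f (f t) = t].
Proof.
move=> mM cf sf.
have finj : {in `[m, M]%classic &, injective f}.
  move=> x y xD yD fxy; apply/eqP; rewrite eq_le !leNgt.
  case: sf => sf; apply/andP; split; apply/negP => h;
    by [have := sf _ _ xD yD h; rewrite fxy ltxx |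
        have := sf _ _ yD xD h; rewrite fxy ltxx].
have fmM : f m != f M.
  apply/eqP => /finj; rewrite !inE /= !bound_itvE => /(_ (ltW mM) (ltW mM)) e.
  by rewrite e ltxx in mM.
have finj' : {in `[m, M] &, injective f}.
  by move=> x y xD yD; apply: finj; rewrite inE.
have fK : {in `[m, M], cancel f (finv_on m M f)}.
  by move=> x xD; apply: pinvKV => //; rewrite inE.
exists (Num.min (f m) (f M)), (Num.max (f m) (f M)); split.
- by case: (ltgtP (f m) (f M)) fmM.
- by case: (ltgtP (f m) (f M)) => [h|h|<-]; [left|right|left].
- exact: continuous_inj_image_segment (ltW mM) cf finj'.
- exact: segment_can_continuous (ltW mM) cf fK.
- by move=> t tD; apply: fK; rewrite in_itv.
Qed.

End RealAnalysis.

(** * Positive maps *)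

Section PositiveMaps.
Context {R : realType} {H K : hilbertType R}.

(** A self-adjoint operator is a difference of positive ones, [(A + k) - k]. *)
Lemma sa_positive_map (P : {linear 'B(H) -> 'B(K)}) A : positive_map P ->
  selfadjoint A -> selfadjoint (P A).
Proof.
move=> pP sA; have [k k0 hk] := sa_bound sA.
have p1 : posop (1 : 'B(H)).
  by apply/posopP; split=> [|x]; [exact: sa1 | rewrite qf1 nsq_ge0].
have pk : posop (A + k%:C *: (1 : 'B(H))).
  apply/posopP; split=> [|x]; first by apply/saD/saZ/sa1.
  by rewrite !qfE; have /andP[] := hk x; lra.
have -> : A = (A + k%:C *: (1 : 'B(H))) - k%:C *: (1 : 'B(H)) by rewrite addrK.
rewrite linearB linearZ; apply: saB; first by have /posopP[] := pP _ pk.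
by apply: saZ; have /posopP[] := pP _ p1.
Qed.

Variables (n : nat) (Phi : 'I_n -> {linear 'B(H) -> 'B(K)}).
Hypothesis Phi_pos : forall i, positive_map (Phi i).

Lemma sa_sum_positive (B : 'I_n -> 'B(H)) : (forall i, selfadjoint (B i)) ->
  selfadjoint (\sum_(i < n) Phi i (B i)).
Proof. by move=> sB; apply: sa_sum => i _; exact: sa_positive_map. Qed.

Lemma qf_sum_positive_le (B C : 'I_n -> 'B(H)) :
  (forall i, selfadjoint (B i)) -> (forall i, selfadjoint (C i)) ->
  (forall i x, qf (B i) x <= qf (C i) x) ->
  forall x, qf (\sum_(i < n) Phi i (B i)) x <= qf (\sum_(i < n) Phi i (C i)) x.
Proof.
move=> sB sC BC; apply: (leopP (sa_sum_positive sB) (sa_sum_positive sC)).1.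
rewrite /leop -sumrB => x; rewrite bop_sumE.
have -> : inner (\sum_(i < n) (Phi i (C i) - Phi i (B i)) x) x =
    \sum_(i < n) inner ((Phi i (C i) - Phi i (B i)) x) x :> R[i].
  by elim/big_rec2: _ => [|i u v _ <-]; rewrite ?inner0l // innerDl.
apply: sumr_ge0 => i _; rewrite -linearB; apply: Phi_pos.
exact: (leopP (sB i) (sC i)).2.
Qed.

Hypothesis Phi_unital : \sum_(i < n) Phi i 1 = 1.

Lemma sum_positive_scalar (c : R) :
  \sum_(i < n) Phi i (c%:C *: (1 : 'B(H))) = c%:C *: (1 : 'B(K)).
Proof.
rewrite -Phi_unital scaler_sumr; apply: eq_bigr => i _.
by rewrite linearZ.
Qed.

Lemma sum_positive_bounds (B : 'I_n -> 'B(H)) (a b : R) :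
  (forall i, selfadjoint (B i)) ->
  (forall i x, a * nsq x <= qf (B i) x <= b * nsq x) ->
  forall x, a * nsq x <= qf (\sum_(i < n) Phi i (B i)) x <= b * nsq x.
Proof.
move=> sB hB x.
have sc (c : R) : selfadjoint (c%:C *: (1 : 'B(H))) by apply/saZ/sa1.
apply/andP; split.
  have := @qf_sum_positive_le (fun=> a%:C *: (1 : 'B(H))) B _ sB _ x.
  rewrite sum_positive_scalar !qfE; apply=> // i y.
  by rewrite !qfE; have /andP[] := hB i y.
have := @qf_sum_positive_le B (fun=> b%:C *: (1 : 'B(H))) sB _ _ x.
rewrite sum_positive_scalar !qfE; apply=> // i y.
by rewrite !qfE; have /andP[] := hB i y.
Qed.

Definition quadratic (u v w : R) : {poly R} := u *: 'X^2 + v *: 'X + w%:P.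

Lemma horner_quadratic u v w t :
  (quadratic u v w).[t] = u * t ^+ 2 + v * t + w.
Proof. by rewrite /quadratic !hornerE. Qed.

Lemma op_quadratic (L : hilbertType R) u v w (B : 'B(L)) :
  op_poly (quadratic u v w) B =
  u%:C *: B ^+ 2 + v%:C *: B + w%:C *: (1 : 'B(L)).
Proof.
by rewrite /quadratic !op_polyD !op_polyZ op_polyC expr2 op_polyM op_polyX -expr2.
Qed.

Lemma qf_sqr (L : hilbertType R) (B : 'B(L)) x : selfadjoint B ->
  qf (B ^+ 2) x = nsq (B x).
Proof. by move=> sB; rewrite /qf expr2 bopME sB. Qed.

(** * The reflected sum and its quadratic defect *)

Variables (B : 'I_n -> 'B(H)) (a b : R).
Hypothesis sB : forall i, selfadjoint (B i).

Let S : 'B(K) := \sum_(i < n) Phi i (B i).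

Definition reflected_sum : 'B(K) := (a + b)%:C *: (1 : 'B(K)) - S.

(** By unitality this is half the sum of [(S - a)(b - S)] and of the images under [Phi i] of
    [(B i - a)(b - B i)]. *)
Definition mercer_defect : 'B(K) :=
  (a + b)%:C *: S - (a * b)%:C *: (1 : 'B(K))
  - (2^-1 : R)%:C *: (S ^+ 2 + \sum_(i < n) Phi i (B i ^+ 2)).

Lemma sa_reflected_sum : selfadjoint reflected_sum.
Proof. by apply/saB/sa_sum_positive/sB/saZ/sa1. Qed.

Lemma sa_mercer_defect : selfadjoint mercer_defect.
Proof.
have sS : selfadjoint S by exact: sa_sum_positive.
apply: saB; first by apply: saB; apply: saZ => //; exact: sa1.
by apply/saZ/saD; [exact: saX | apply: sa_sum_positive => i; exact: saX].
Qed.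

(** Affine terms produce no defect. For the square, [(a + b - S)^2] equals [a^2 + b^2] minus the sum
    of the [Phi i (B i ^+ 2)] minus twice the defect, so a leading coefficient [u / 2] contributes
    [u] times the defect. *)
Lemma qf_mercer_quadratic (u v w : R) x :
  qf (op_poly (quadratic (u / 2) v w) reflected_sum) x =
  ((quadratic (u / 2) v w).[a] + (quadratic (u / 2) v w).[b]) * nsq x
  - qf (\sum_(i < n) Phi i (op_poly (quadratic (u / 2) v w) (B i))) x
  - u * qf mercer_defect x.
Proof.
have sS : selfadjoint S by exact: sa_sum_positive.
have -> : \sum_(i < n) Phi i (op_poly (quadratic (u / 2) v w) (B i)) =
    (u / 2)%:C *: (\sum_(i < n) Phi i (B i ^+ 2)) + v%:C *: S
    + w%:C *: (1 : 'B(K)).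
  rewrite -sum_positive_scalar !scaler_sumr -!big_split; apply: eq_bigr => i _.
  by rewrite op_quadratic !linearD !linearZ.
rewrite op_quadratic !horner_quadratic !qfE qf_sqr; last exact: sa_reflected_sum.
have -> : nsq (reflected_sum x) =
    (a + b) ^+ 2 * nsq x - 2 * (a + b) * qf S x + nsq (S x).
  have -> : reflected_sum x = (a + b)%:C *: x + - S x by [].
  rewrite nsqD nsqZ nsqN innerNr innerZl -mulrN ReZ.
  have -> : complex.Re (- inner x (S x)) = - qf S x.
    by rewrite /qf sS; case: (inner _ _).
  ring.
by rewrite (qf_sqr _ sS); field.
Qed.

Hypothesis ab : a < b.
Hypothesis Bab : forall i x, a * nsq x <= qf (B i) x <= b * nsq x.

Lemma spectrum_reflected_sum : spectrum_in reflected_sum `[a, b].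
Proof.
apply: qf_spectrum_in => [|x]; first exact: sa_reflected_sum.
have /andP[] := sum_positive_bounds sB Bab x.
by rewrite /reflected_sum !qfE -/S => ? ?; apply/andP; split; lra.
Qed.

(* Both [(S - a)(b - S)] and [(B i - a)(b - B i)] are positive. *)
Lemma qf_mercer_defect_ge0 x : 0 <= qf mercer_defect x.
Proof.
have sS : selfadjoint S by exact: sa_sum_positive.
have h1 := qf_between sS ab (sum_positive_bounds sB Bab) x.
have sp i : selfadjoint (op_poly (quadratic 0 (a + b) (- (a * b))) (B i)).
  exact: sa_op_poly.
have := @qf_sum_positive_le (fun i => B i ^+ 2) _ (fun i => saX 2 (sB i)) sp _ x.
have -> : \sum_(i < n) Phi i (op_poly (quadratic 0 (a + b) (- (a * b))) (B i)) =
    (a + b)%:C *: S + (- (a * b))%:C *: (1 : 'B(K)).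
  rewrite -sum_positive_scalar !scaler_sumr -!big_split.
  by apply: eq_bigr => i _; rewrite op_quadratic scale0r add0r linearD !linearZ.
rewrite !qfE mulNr => h2.
have {}h2 : qf (\sum_(i < n) Phi i (B i ^+ 2)) x <=
    (a + b) * qf S x - a * b * nsq x.
  apply: h2 => i y; rewrite op_quadratic !qfE mul0r add0r mulNr qf_sqr //.
  exact: qf_between.
by rewrite (qf_sqr _ sS); lra.
Qed.

End PositiveMaps.

(** * The main theorem *)

(** This cancels [psi] against its inverse in [cfc psi Mpsi]. *)
Lemma cfc_id_of_comp (R : realType) (H : hilbertType R) (f g : R -> R)
  (A : 'B(H)) (c d m M : R) : selfadjoint A -> c < d -> m < M ->
  spectrum_in A `[c, d] -> {within `[c, d], continuous g} ->
  {within `[m, M], continuous f} ->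
  (forall t, c <= t <= d -> m <= g t <= M /\ f (g t) = t) ->
  cfc f (cfc g A) = A.
Proof.
move=> sA cd mM Acd cg cf fg.
have Acd' (t : R) : spectrum A t%:C -> c <= t <= d.
  by move=> /Acd[s]; rewrite /= in_itv /= => sab [<-].
have hg := is_cfc_cfc sA cd Acd cg.
have gmM t : spectrum A t%:C -> m <= g t <= M by move=> /Acd' /fg[].
have h := is_cfc_comp sA hg mM gmM cf.
have hX := is_cfc_poly 'X A; rewrite op_polyX in hX.
apply: is_cfc_eq h hX _ => // t /Acd' /fg[_ /= ->].
by rewrite hornerX.
Qed.

(* The functional calculus [cfc psiinv T] makes sense only if the spectrum of [T]
   lies in [psi @` `[m, M]], the domain of the inverse function of [psi].  For
   [T = cfc psi Mpsi - alpha *: K0] in (i) this is automatic when [0 <= alpha],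
   and in (ii) when [beta <= 0]; for the other signs it can fail and is
   assumed. *)
Theorem theorem3p2 (R : realType) (H K : hilbertType R) (m M : R) (n : nat)
  (A : 'I_n -> 'B(H)) (Phi : 'I_n -> {linear 'B(H) -> 'B(K)})
  (phi psi : R -> R)
  (m_gt0 : 0 < m) (ltmM : m < M)
  (A_pos : forall i, posop (A i))
  (A_inv : forall i, invertible (A i))
  (A_spec : forall i, spectrum_in (A i) `[m, M])
  (Phi_pos : forall i, positive_map (Phi i))
  (Phi_unital : \sum_(i < n) Phi i 1 = 1)
  (phi_cont : {within `[m, M], continuous phi})
  (phi_mono : strictly_monotone `[m, M] phi)
  (psi_cont : {within `[m, M], continuous psi})
  (psi_mono : strictly_monotone `[m, M] psi)
  (twice_diff : twice_derivable_on (phi @` `[m, M]) (psi \o finv_on m M phi)) :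
  let Mphi := mercer_mean m M A Phi phi in
  let Mpsi := mercer_mean m M A Phi psi in
  let K0 := mercer_K m M A Phi phi in
  let f'' := deriv2_on (phi @` `[m, M]) (psi \o finv_on m M phi) in
  let psiinv := finv_on m M psi in
  (forall alpha : R,
     (forall t, (phi @` `[m, M]) t -> alpha <= f'' t) ->
     operator_monotone (psi @` `[m, M]) psiinv ->
     (alpha < 0 -> spectrum_in (cfc psi Mpsi - alpha%:C *: K0) (psi @` `[m, M])) ->
     leop Mphi (cfc psiinv (cfc psi Mpsi - alpha%:C *: K0))) /\
  (forall beta : R,
     (forall t, (phi @` `[m, M]) t -> f'' t <= beta) ->
     operator_monotone (psi @` `[m, M]) psiinv ->
     (0 < beta -> spectrum_in (cfc psi Mpsi - beta%:C *: K0) (psi @` `[m, M])) ->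
     leop (cfc psiinv (cfc psi Mpsi - beta%:C *: K0)) Mphi).
Proof.
move=> Mphi Mpsi K0 f'' psiinv.
have sA i : selfadjoint (A i) by have /posopP[] := A_pos i.
have [a [b [ab abE phiJ cphii phiK]]] :=
  strictly_monotone_inverse ltmM phi_cont phi_mono.
have [c [d [cd cdE psiJ cpsii psiK]]] :=
  strictly_monotone_inverse ltmM psi_cont psi_mono.
pose phiinv := finv_on m M phi.
have phiP t : m <= t <= M -> a <= phi t <= b.
  move=> tmM; have : (phi @` `[m, M]) (phi t) by exists t => //=; rewrite in_itv.
  by rewrite phiJ /= in_itv.
have psiP t : m <= t <= M -> c <= psi t <= d.
  move=> tmM; have : (psi @` `[m, M]) (psi t) by exists t => //=; rewrite in_itv.
  by rewrite psiJ /= in_itv.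
have phiiP s : a <= s <= b -> m <= phiinv s <= M /\ phi (phiinv s) = s.
  move=> sab; have : (phi @` `[m, M]) s by rewrite phiJ /= in_itv.
  by move=> [t]; rewrite /= in_itv /= => tmM <-; rewrite /phiinv phiK.
have psiiP s : c <= s <= d -> m <= psiinv s <= M /\ psi (psiinv s) = s.
  move=> scd; have : (psi @` `[m, M]) s by rewrite psiJ /= in_itv.
  by move=> [t]; rewrite /= in_itv /= => tmM <-; rewrite /psiinv psiK.
have Aspec i (t : R) : spectrum (A i) t%:C -> m <= t <= M.
  by move=> /A_spec[s]; rewrite /= in_itv /= => sab [<-].
pose B i := cfc phi (A i); pose C i := cfc psi (A i).
have hB i : is_cfc phi (A i) (B i) := is_cfc_cfc (sA i) ltmM (A_spec i) phi_cont.
have hC i : is_cfc psi (A i) (C i) := is_cfc_cfc (sA i) ltmM (A_spec i) psi_cont.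
have sB i : selfadjoint (B i) := is_cfc_sa (sA i) (hB i).
have sC i : selfadjoint (C i) := is_cfc_sa (sA i) (hC i).
have Bab i x : a * nsq x <= qf (B i) x <= b * nsq x.
  apply: spectrum_in_qf x => //.
  by apply: is_cfc_spectrum_in (hB i) _ => // t /Aspec /phiP.
have Ccd i x : c * nsq x <= qf (C i) x <= d * nsq x.
  apply: spectrum_in_qf x => //.
  by apply: is_cfc_spectrum_in (hC i) _ => // t /Aspec /psiP.
pose X := reflected_sum Phi B a b.
pose Y := reflected_sum Phi C c d.
have sX : selfadjoint X := sa_reflected_sum Phi_pos a b sB.
have sY : selfadjoint Y := sa_reflected_sum Phi_pos c d sC.
have Xab : spectrum_in X `[a, b] :=
  spectrum_reflected_sum Phi_pos Phi_unital sB Bab.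
have Ycd : spectrum_in Y `[c, d] :=
  spectrum_reflected_sum Phi_pos Phi_unital sC Ccd.
have XJ (t : R) : spectrum X t%:C -> a <= t <= b.
  by move=> /Xab[s]; rewrite /= in_itv /= => sab [<-].
have abD : phi M + phi m = a + b by case: abE => -[-> ->] //; rewrite addrC.
have abM : phi M * phi m = a * b by case: abE => -[-> ->] //; rewrite mulrC.
have cdD : psi M + psi m = c + d by case: cdE => -[-> ->] //; rewrite addrC.
have MphiE : Mphi = cfc phiinv X by rewrite /Mphi /mercer_mean abD.
have MpsiE : cfc psi Mpsi = Y.
  have -> : Mpsi = cfc psiinv Y by rewrite /Mpsi /mercer_mean cdD.
  exact: cfc_id_of_comp sY cd ltmM Ycd cpsii psi_cont psiiP.
have K0E : K0 = mercer_defect Phi B a b by rewrite /K0 /mercer_K abD abM.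
have sK0 : selfadjoint K0 by rewrite K0E; exact: sa_mercer_defect.
have K0_ge0 x : 0 <= qf K0 x.
  by rewrite K0E; exact: qf_mercer_defect_ge0.
have key (alpha c1 c0 : R) x :
    qf (op_poly (quadratic (alpha / 2) c1 c0) X) x =
      ((quadratic (alpha / 2) c1 c0).[a] + (quadratic (alpha / 2) c1 c0).[b])
        * nsq x -
      qf (\sum_(i < n) Phi i (op_poly (quadratic (alpha / 2) c1 c0) (B i))) x -
      alpha * qf K0 x.
  by rewrite K0E; exact: qf_mercer_quadratic.
have YE x : qf Y x = (c + d) * nsq x - qf (\sum_(i < n) Phi i (C i)) x.
  by rewrite /Y /reflected_sum !qfE.
clear K0E; clearbody X Y K0 Mphi Mpsi; clearbody B C.
have sT (r : R) : selfadjoint (Y - r%:C *: K0) by apply/saB/saZ/sK0.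
have TE (r : R) x : qf (Y - r%:C *: K0) x = qf Y x - r * qf K0 x.
  by rewrite qfD qfN qfZ.
pose f := psi \o phiinv.
have cf : {within `[a, b], continuous f}.
  apply: within_continuous_comp cphii _ psi_cont => s.
  by rewrite /= !in_itv /= => /phiiP[].
have fcd t : a <= t <= b -> c <= f t <= d by move=> /phiiP[/psiP].
have fphi t : m <= t <= M -> f (phi t) = psi t.
  by move=> tmM; rewrite /f /= /phiinv phiK.
have fD : f a + f b = c + d.
  have mmM : m <= m <= M by rewrite lexx ltW.
  have MmM : m <= M <= M by rewrite lexx ltW.
  by case: abE => -[-> ->]; rewrite !fphi // -cdD // addrC.
(* [F] plays the part of [psi(Mphi)]: the composition rule gives [cfc psiinv F = Mphi], so the claim
   becomes a comparison of [F] with [Y - r K0] under [psiinv]. *)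
pose F := cfc f X.
have hF : is_cfc f X F := is_cfc_cfc sX ab Xab cf.
have sF : selfadjoint F := is_cfc_sa sX hF.
have Fcd : spectrum_in F `[c, d] by apply: is_cfc_spectrum_in hF _ => // t /XJ /fcd.
have FE : cfc psiinv F = Mphi.
  have h := is_cfc_comp sX hF cd (fun t tX => fcd t (XJ t tX)) cpsii.
  have h' : is_cfc phiinv X Mphi by rewrite MphiE; exact: is_cfc_cfc sX ab Xab cphii.
  apply: is_cfc_eq h h' _ => // t /XJ tab.
  by rewrite /f /=; apply: psiK; have [] := phiiP t tab.
have [d1 d2] := twice_diff.
have J t : a < t < b -> (phi @` `[m, M]) t.
  by move=> /andP[? ?]; rewrite phiJ /= in_itv /=; apply/andP; split; apply: ltW.
have df t : a < t < b -> is_derive t 1 f (deriv_on `[a, b] f t).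
  by move=> tab; apply: deriv_on_is_derive; rewrite -?phiJ //; apply/d1/J.
have df1 t : a < t < b -> is_derive t 1 (deriv_on `[a, b] f) (f'' t).
  move=> tab; rewrite /f'' /deriv2_on phiJ; apply: deriv_on_is_derive => //.
  by have := d2 _ (J t tab); rewrite phiJ.
have hq i (q : {poly R}) : is_cfc (fun t => q.[phi t]) (A i) (op_poly q (B i)).
  apply: (is_cfc_horner q (sA i) (hB i) (c := `|a| + `|b|)) => t.
  move=> /Aspec /phiP /andP[h1 h2].
  have := ler_norm b; have := ler_norm (- a); rewrite normrN.
  by have := normr_ge0 a; have := normr_ge0 b => ? ? ? ?;
    rewrite ler_norml; apply/andP; split; lra.
clearbody F f'' f phiinv psiinv.
have /spectrum_in_qf := Ycd; move=> /(_ sY) Yqf.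
have /spectrum_in_qf := Fcd; move=> /(_ sF) Fqf.
rewrite MpsiE -FE; split=> r hr psi_mon hT.
- have [c1 [c0 [fa fb]]] := quadratic_interpolation f r ab.
  have fq t : a <= t <= b -> f t <= (quadratic (r / 2) c1 c0).[t].
    rewrite horner_quadratic; apply: le_quadratic cf df df1 _ fa fb t => t tab.
    exact/hr/J.
  have FT x : qf F x <= qf (Y - r%:C *: K0) x.
    have fqX t (tX : spectrum X t%:C) := fq t (XJ t tX).
    apply: le_trans (is_cfc_le sX hF (is_cfc_poly _ X) fqX x) _.
    (* Interpolation turns [q(a) + q(b)] into [c + d], the constant of [Y], and the defect terms
       cancel. What remains compares the sums of [Phi i (psi (A i))] and [Phi i (q (phi (A i)))]. *)
    rewrite key !horner_quadratic -fa -fb fD TE YE lerD2r lerD2l lerN2.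
    apply: (qf_sum_positive_le Phi_pos sC) => i; first exact: sa_op_poly.
    apply: is_cfc_le (hC i) (hq i _) _ => // t /Aspec tmM.
    by rewrite -fphi //; apply/fq/phiP.
  apply: psi_mon.2 => //; rewrite ?psiJ //; last exact/leopP.
  have [r0|r0] := ltP r 0; first by rewrite -psiJ; exact: hT.
  (* For [0 <= r] both bounds are automatic: the operator is at least [F >= c], and at most [Y <= d]
     because [K0] is positive. *)
  apply: qf_spectrum_in => // x; apply/andP; split.
    by apply: le_trans (FT x); have /andP[] := Fqf x.
  rewrite TE; have /andP[_ h] := Yqf x.
  by have := mulr_ge0 r0 (K0_ge0 x); lra.
- have [c1 [c0 [fa fb]]] := quadratic_interpolation f r ab.
  have fq t : a <= t <= b -> (quadratic (r / 2) c1 c0).[t] <= f t.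
    rewrite horner_quadratic; apply: ge_quadratic cf df df1 _ fa fb t => t tab.
    exact/hr/J.
  have FT x : qf (Y - r%:C *: K0) x <= qf F x.
    have fqX t (tX : spectrum X t%:C) := fq t (XJ t tX).
    apply: le_trans (is_cfc_le sX (is_cfc_poly _ X) hF fqX x).
    rewrite key !horner_quadratic -fa -fb fD TE YE lerD2r lerD2l lerN2.
    apply: (qf_sum_positive_le Phi_pos _ sC) => i; first exact: sa_op_poly.
    apply: is_cfc_le (hq i _) (hC i) _ => // t /Aspec tmM.
    by rewrite -fphi //; apply/fq/phiP.
  apply: psi_mon.2 => //; rewrite ?psiJ //; last exact/leopP.
  have [r0|r0] := ltP 0 r; first by rewrite -psiJ; exact: hT.
  (* For [r <= 0] the roles are exchanged: [F <= d] bounds the operator above and [Y >= c] below. *)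
  apply: qf_spectrum_in => // x; apply/andP; split; last first.
    by apply: le_trans (FT x) _; have /andP[] := Fqf x.
  rewrite TE; have /andP[h _] := Yqf x.
  by have := mulr_le0_ge0 r0 (K0_ge0 x); lra.
Qed.
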